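(* Let $\sigma$ be a primitive invertible substitution on the two-letter alphabet $\{a,b\}$ whose substitution matrix has determinant $1$, let $s$ be the tile-substitution associated with $\sigma$, let $s^{\star}$ be its star-dual tile-substitution, let $\sigma^{*}$ be the dual substitution of $\sigma$ and let $\overline{\sigma}$ be the reciprocal substitution of $\sigma$. Then $$\mathbf{X}^{*}_{\sigma}\cong \mathbf{X}_{\sigma^{*}}\cong \mathcal{X}_{\overline{\sigma}}\cong \mathcal{X}_{\sigma^{*}}\cong \mathbb{X}_{s^{\star}},$$ where $\mathbf{X}^{*}_{\sigma}$ is the dual strand space of $\sigma$, $\mathbf{X}_{\sigma^{*}}$ is the strand space of $\sigma^{*}$, $\mathcal{X}_{\overline{\sigma}}$ and $\mathcal{X}_{\sigma^{*}}$ are the hulls of $\overline{\sigma}$ and $\sigma^{*}$, and $\mathbb{X}_{s^{\star}}$ is the tiling space of $s^{\star}$.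
   Context: **Word substitutions.** Let $\mathcal{A}=\{a,b\}$, let $\mathcal{A}^*$ be the set of finite words over $\mathcal A$ and $\mathcal{A}^{\mathbb{Z}}$ the set of bi-infinite words. A substitution $\sigma$ is a map sending each letter to a nonempty word, extended by concatenation. Write $\sigma(j)=\sigma(j)_1\cdots\sigma(j)_{|\sigma(j)|}$, let $|w|_i$ be the number of occurrences of the letter $i$ in $w$, and let $A(w)=(|w|_a,|w|_b)\in\mathbb{Z}^2$. The substitution matrix is $M_\sigma=(|\sigma(j)|_i)_{i,j\in\{a,b\}}$. $\sigma$ is primitive if $M_\sigma^n>0$ entrywise for some $n\in\mathbb{N}$, and invertible if the endomorphism of the free group $F_2=\langle a,b\rangle$ it induces is an automorphism. The inflation factor $\lambda>1$ is the Perron-Frobenius eigenvalue of $M_\sigma$. The hull is $\mathcal{X}_\sigma=\{u\in\mathcal{A}^{\mathbb{Z}}\mid \text{each finite subword of } u \text{ is a subword of } \sigma^n(a)\text{ or }\sigma^n(b)\text{ for some } n\}$. **Reciprocal substitution.** Let $\tau_a\in\mathrm{Aut}(F_2)$, $\tau_a: a\mapsto a^{-1},\ b\mapsto b$. For $\sigma$ invertible with $\det M_\sigma=1$, $\overline{\sigma}:=\tau_a\sigma^{-1}\tau_a^{-1}$; it is a substitution on $\{a,b\}$. **Strands.** Let $(e_a,e_b)$ be the canonical basis of $\mathbb{R}^2$. A bi-infinite (resp. finite) strand is a lattice path in $\mathbb{R}^2$ given by $\gamma:\mathbb{Z}\to\mathbb{Z}^2$ (resp. $\gamma$ on an integer interval)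 with each step $\gamma(k+1)-\gamma(k)\in\{e_a,e_b\}$, consecutive vertices being joined by unit segments. The strand coding $\psi$ sends it to the word $(w_k)$ with $\gamma(k+1)-\gamma(k)=e_{w_k}$. The elementary strand $(W,i)$, for $W\in\mathbb{Z}^2$ and $i\in\mathcal{A}$, is the segment $\{W+t e_i\mid 0\le t\le 1\}$. The map $E_1(\sigma)$ is the linear map on formal sums of elementary strands with $E_1(\sigma)(W,i)=\sum_{k=1}^{|\sigma(i)|}\big(M_\sigma W+A(\sigma(i)_1\cdots\sigma(i)_{k-1}),\sigma(i)_k\big)$. The strand space $\mathbf{X}_\sigma$ is the set of bi-infinite strands each of whose finite substrands is a substrand of some $E_1(\sigma)^n(W,x)$, with $W\in\mathbb{Z}^2$, $n\in\mathbb{N}$, $x\in\{a,b\}$ (formal sums being viewed as unions of segments). **Dual strands.** The elementary dual strands are $(W,a^* )=\{W+te_b\mid 0\le t\le1\}$ and $(W,b^* )=\{W+te_a\mid 0\le t\le1\}$, for $W\in\mathbb{Z}^2$. A finite (resp. bi-infinite) dual strand is a lattice path given by $\gamma$ on an integer interval (resp. on $\mathbb{Z}$) with values in $\mathbb{Z}^2$ and each step $\gamma(k+1)-\gamma(k)\in\{e_a,-e_b\}$, consecutive vertices being joined by unit segments. The dual coding $\psi^*$ sends it to the word $(w_k)$ with $w_k=b$ if $\gamma(k+1)-\gamma(k)=e_a$ and $w_k=a$ if $\gamma(k+1)-\gamma(k)=-e_b$. For $\sigma$ unimodular ($\det M_\sigma=\pm1$), the dual map $E_1^*(\sigma)$ is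 the linear map on formal sums of elementary dual strands with $$E_1^*(\sigma)(W,i^* )=\sum_{j,k:\ \sigma(j)_k=i}\Big(M_\sigma^{-1}\big(W+A(\sigma(j)_{k+1}\cdots\sigma(j)_{|\sigma(j)|})\big),j^*\Big).$$ For $\sigma$ primitive and invertible, $E_1^*(\sigma)$ maps finite dual strands to finite dual strands. The dual strand space $\mathbf{X}^*_\sigma$ is the set of bi-infinite dual strands each of whose finite substrands is a substrand of some $E_1^*(\sigma)^n(W,x^* )$, with $W\in\mathbb{Z}^2$, $n\in\mathbb{N}$, $x\in\{a,b\}$. For $\sigma$ primitive invertible with $\det M_\sigma=1$, the dual substitution $\sigma^*$ is defined on $\{a,b\}$ by $\sigma^*(x)=\psi^*(E_1^*(\sigma)(0,x^* ))$. **Tile-substitutions.** A (self-similar) tile-substitution in $\mathbb{R}$ with two prototiles is given by compact intervals $T_1,T_2$, an inflation factor $\lambda>1$, and a digit set matrix $\mathcal{D}=(\mathcal{D}_{ij})_{1\le i,j\le 2}$ of finite subsets of $\mathbb{R}$ such that $\lambda T_j=\bigcup_{i}(T_i+\mathcal{D}_{ij})$ with non-overlapping interiors; then $s(T_j)=\{T_i+d\mid d\in\mathcal{D}_{ij},\ i=1,2\}$, extended by $s(T_j+x)=s(T_j)+\lambda x$. It is primitive if the matrix $(|\mathcal{D}_{ij}|)$ is. A primitive tile-substitution is determined by $\mathcal{D}$: $\lambda$ is the largest eigenvalue of $(|\mathcal{D}_{ij}|)$ and $(T_1,T_2)$ is the unique solution in nonempty compact sets of the set equations $\lambda T_j=\bigcup_{i=1}^{2}(T_i+\mathcal{D}_{ij})$,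 $j=1,2$. The tiling space $\mathbb{X}_s$ is the set of all tilings of $\mathbb{R}$ each of whose finite sets of tiles is contained in a translate of some $s^n(T_1)$ or $s^n(T_2)$. The tile-substitution $s$ associated with $\sigma$ is: let $(1,\ell_\lambda)$ be the left eigenvector of $M_\sigma$ for $\lambda$ with first coordinate $1$; the prototiles are $T_a=[0,1]$, $T_b=[0,\ell_\lambda]$, and the digit sets are $\mathcal{D}_{ij}=\{\delta(\sigma(j)_1\cdots\sigma(j)_{k-1})\mid \sigma(j)_k=i\}$ with $\delta(w)=|w|_a+|w|_b\,\ell_\lambda$. One writes $\sigma\cong s$ when a word substitution and a tile-substitution correspond in this way (conversely, a tile-substitution with interval tiles yields a word substitution by reading the images of the tiles from left to right and replacing tiles by letters). The star map is algebraic conjugation in $\mathbb{Q}(\lambda)$: $(\alpha+\beta\ell_\lambda)^\star=\alpha+\beta\ell_\lambda'$ for $\alpha,\beta\in\mathbb{Q}$, where $\ell'_\lambda$ is the algebraic conjugate of $\ell_\lambda$. The star-dual $s^\star$ is the tile-substitution with digit set matrix $(\mathcal{D}^T)^\star$, i.e. the transpose of $\mathcal{D}$ with the star map applied to every digit. **Equivalences $\cong$.** (i) For hulls: $\mathcal{X}_\sigma\cong\mathcal{X}_\rho$ if $\mathcal{X}_\sigma=\mathcal{X}_\rho$ or $\mathcal{X}_\sigma=E(\mathcal{X}_\rho)$, where $E$ exchanges $a$ and $b$. (ii) $\mathbb{X}_s\cong\mathbb{X}_{s'}$ if there is a similarity $x\mapsto cx+t$ ($c>0$, $t\in\mathbb{R}$)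 mapping $\mathbb{X}_s$ one-to-one onto $\mathbb{X}_{s'}$. (iii) $\mathcal{X}_\sigma\cong\mathbb{X}_s$ whenever $\sigma\cong s$. (iv) $\mathcal{X}_\sigma\cong\mathbf{X}_{\rho}$ if $\psi(\mathbf{X}_{\rho})=\mathcal{X}_\sigma$; $\mathcal{X}_\sigma\cong\mathbf{X}^*_{\rho}$ if $\psi^*(\mathbf{X}^*_{\rho})=\mathcal{X}_\sigma$; $\mathbf{X}_\sigma\cong\mathbf{X}_{\rho}$ if $\psi(\mathbf{X}_\sigma)=\psi(\mathbf{X}_{\rho})$. Between spaces of different types, $\cong$ is the equivalence relation generated by (i)-(iv). *)

(* Defs.v *)
From HB Require Import structures.
From Stdlib Require Import Relations.
From mathcomp Require Import all_boot all_order all_algebra finmap.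
From mathcomp Require Import all_classical all_reals all_analysis.
Set Implicit Arguments.
Unset Strict Implicit.
Unset Printing Implicit Defensive.
Import Order.TTheory GRing.Theory Num.Theory.
Import numFieldNormedType.Exports.
Local Open Scope classical_set_scope.
Local Open Scope ring_scope.

Definition letter := 'I_2.
Definition la : letter := ord0.
Definition lb : letter := ord_max.
Definition swap_letter (i : letter) : letter := if i == la then lb else la.

Definition word := seq letter.
Definition substitution := letter -> word.

Definition nonerasing (sigma : substitution) := forall i, sigma i != [::].

Definition subst_word (sigma : substitution) (w : word) : word :=
  flatten [seq sigma i | i <- w].

Definition point := 'cV[int]_2.
Definition e_ (i : letter) : point := delta_mx i 0.

Definition abel (w : word) : point := \col_i (count_mem i w)%:Z.

Definition subst_mx (sigma : substitution) : 'M[int]_2 :=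
  \matrix_(i, j) (count_mem i (sigma j))%:Z.

Definition primitive_mx (M : 'M[int]_2) : Prop :=
  exists n : nat, forall i j, 0 < (M ^+ n) i j.

Definition primitive (sigma : substitution) := primitive_mx (subst_mx sigma).

Definition biword := int -> letter.

Definition hull (sigma : substitution) : set biword :=
  [set u | forall (m : int) (n : nat), exists (x : letter) (k : nat),
     infix [seq u (m + i%:Z) | i <- iota 0 n]
           (iter k (subst_word sigma) [:: x])].

(* [(i, false)] stands for the generator [i], [(i, true)] for its inverse. *)
Definition signed_letter := (letter * bool)%type.
Definition sinv (x : signed_letter) : signed_letter := (x.1, ~~ x.2).
Definition reduced (w : seq signed_letter) : bool :=
  sorted (fun x y => y != sinv x) w.
Definition red_cons (x : signed_letter) (w : seq signed_letter) :=
  if w is y :: w' then if y == sinv x then w' else x :: w else [:: x].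
Definition reduce (w : seq signed_letter) := foldr red_cons [::] w.

Lemma sinvK : involutive sinv.
Proof. by case=> i b; rewrite /sinv /= negbK. Qed.

Lemma reduced_red_cons x w : reduced w -> reduced (red_cons x w).
Proof.
case: w => [|y w] //= yw; case: eqP => [_|/eqP xy].
  by apply: path_sorted yw.
by rewrite /= xy.
Qed.

Lemma reduced_foldr u w : reduced w -> reduced (foldr red_cons w u).
Proof. by elim: u => //= x u IHu /IHu; apply: reduced_red_cons. Qed.

Lemma reduced_reduce w : reduced (reduce w).
Proof. exact: reduced_foldr. Qed.

Lemma red_consK x w : reduced w -> red_cons (sinv x) (red_cons x w) = w.
Proof.
case: w => [|y w] /= yw; first by rewrite sinvK eqxx.
case: eqP => [yx|_] /=; last by rewrite sinvK eqxx.
rewrite -yx; case: w yw => [|z w] //= /andP[zy _].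
by rewrite (negPf zy).
Qed.

Lemma foldr_red_cons x v w : reduced w ->
  foldr red_cons w (red_cons x v) = red_cons x (foldr red_cons w v).
Proof.
move=> rw; case: v => [|y v] //=; case: eqP => [->|//].
have := @red_consK (sinv x) (foldr red_cons w v) (reduced_foldr v rw).
by rewrite sinvK => ->.
Qed.

Lemma foldr_reduce u w : reduced w ->
  foldr red_cons w (reduce u) = foldr red_cons w u.
Proof. by move=> rw; elim: u => //= x u <-; rewrite foldr_red_cons. Qed.

Lemma reduce_id w : reduced w -> reduce w = w.
Proof.
elim: w => //= x w IHw xw; have rw := path_sorted xw.
rewrite -/(reduce w) (IHw rw); case: w xw {IHw rw} => //= y w /andP[xy _].
by rewrite (negPf xy).
Qed.

Lemma reduce_catr u v : reduce (u ++ reduce v) = reduce (u ++ v).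
Proof.
rewrite /reduce !foldr_cat; congr foldr.
exact: reduce_id (reduced_reduce v).
Qed.

Lemma reduce_catl u v : reduce (reduce u ++ v) = reduce (u ++ v).
Proof.
by rewrite /reduce !foldr_cat -/(reduce u) foldr_reduce // reduced_reduce.
Qed.

Lemma reduce_inv u : reduce (rev (map sinv u) ++ u) = [::].
Proof.
elim: u => //= x u IHu; rewrite rev_cons cat_rcons /reduce foldr_cat /=.
by rewrite red_consK ?(reduced_reduce u) // -foldr_cat.
Qed.

Lemma map_sinvK : involutive (fun w => rev (map sinv w)).
Proof. by move=> w; rewrite map_rev revK mapK //; apply: sinvK. Qed.

Definition F2 := {w : seq signed_letter | reduced w}.
HB.instance Definition _ := Choice.on F2.

Definition F2_of (w : seq signed_letter) : F2 := Sub _ (reduced_reduce w).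
Definition F2_mul (u v : F2) : F2 := F2_of (val u ++ val v).
Definition F2_inv (u : F2) : F2 := F2_of (rev (map sinv (val u))).
Definition F2_one : F2 := F2_of [::].

Lemma F2_mulA : associative F2_mul.
Proof.
by move=> u v w; apply: val_inj; rewrite /= reduce_catr reduce_catl catA.
Qed.
Lemma F2_mul1 : left_id F2_one F2_mul.
Proof. by move=> u; apply: val_inj; rewrite /= reduce_id // (valP u). Qed.
Lemma F2_mulr1 : right_id F2_one F2_mul.
Proof. by move=> u; apply: val_inj; rewrite /= cats0 reduce_id // (valP u). Qed.
Lemma F2_mulV : left_inverse F2_one F2_inv F2_mul.
Proof. by move=> u; apply: val_inj; rewrite /= reduce_catl reduce_inv. Qed.
Lemma F2_mulrV : right_inverse F2_one F2_inv F2_mul.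
Proof.
move=> u; apply: val_inj; rewrite /= reduce_catr -[X in X ++ _]map_sinvK.
exact: reduce_inv.
Qed.
HB.instance Definition _ :=
  isGroup.Build F2 F2_mulA F2_mul1 F2_mulr1 F2_mulV F2_mulrV.

Definition F2_gen (i : letter) : F2 := F2_of [:: (i, false)].
Definition F2_word (w : word) : F2 := F2_of [seq (i, false) | i <- w].

Definition F2_ext (f : letter -> F2) (g : F2) : F2 :=
  (\prod_(x <- val g) (if x.2 then (f x.1)^-1 else f x.1))%g.

Definition F2_end (sigma : substitution) : F2 -> F2 :=
  F2_ext (fun i => F2_word (sigma i)).

Definition invertible (sigma : substitution) : Prop :=
  bijective (F2_end sigma).

Definition F2_inverse (f : F2 -> F2) : F2 -> F2 :=
  'pinv_(fun=> 1%g) [set: F2] f.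

Definition tau_a : F2 -> F2 :=
  F2_ext (fun i => if i == la then (F2_gen i)^-1%g else F2_gen i).

(* [reciprocal sigma x] is the word which, read in [F2], is the image of [x] by
   tau_a sigma^-1 tau_a^-1; for [sigma] invertible with determinant 1 it exists,
   and it is unique since distinct words are distinct in [F2]. *)
Definition reciprocal (sigma : substitution) : substitution := fun x =>
  xget [::] [set w | F2_word w =
    (tau_a \o F2_inverse (F2_end sigma) \o F2_inverse tau_a) (F2_gen x)].

(* Formal sums of elementary strands (W, i), or of elementary dual strands
   (W, i^* ), with coefficients in [nat], are encoded by the sequence of their
   terms, addition being concatenation. *)
Definition fsum := seq (point * letter).

Definition E1 (sigma : substitution) (S : fsum) : fsum :=
  flatten [seq
    [seq (subst_mx sigma *m p.1 + abel (take k (sigma p.2)),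
          nth la (sigma p.2) k)
       | k <- iota 0 (size (sigma p.2))]
    | p <- S].

Definition E1dual (sigma : substitution) (S : fsum) : fsum :=
  flatten [seq
    [seq (invmx (subst_mx sigma) *m (p.1 + abel (drop k.+1 (sigma j))), j)
       | j <- [:: la; lb],
         k <- [seq k <- iota 0 (size (sigma j)) | nth la (sigma j) k == p.2]]
    | p <- S].

Definition lattice_path := int -> point.

(* [dstep w] is the step of a dual strand coded by the letter [w]. *)
Definition dstep (i : letter) : point := if i == la then - e_ lb else e_ la.

Definition strand : set lattice_path :=
  [set g | forall k, exists i, g (k + 1) - g k = e_ i].
Definition dual_strand : set lattice_path :=
  [set g | forall k, exists i, g (k + 1) - g k = dstep i].

(* The images of sets of strands by the codings psi and psi^* *)
Definition codings (X : set lattice_path) : set biword :=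
  [set w | exists2 g, X g & forall k, g (k + 1) - g k = e_ (w k)].
Definition dual_codings (X : set lattice_path) : set biword :=
  [set w | exists2 g, X g & forall k, g (k + 1) - g k = dstep (w k)].

Section Strands.
Variable R : realType.

Definition segment (p q : point) : set 'cV[R]_2 :=
  [set map_mx intr p + t *: map_mx intr (q - p) | t in `[0, 1]%classic].

(* The union of the segments of the substrand of [g] on the integer interval
   [m, m + n] *)
Definition strand_trace (g : lattice_path) (m : int) (n : nat) : set 'cV[R]_2 :=
  \bigcup_(k in [set k : nat | (k < n)%N])
     segment (g (m + k%:Z)) (g (m + k%:Z + 1)).

Definition elem_strand (p : point * letter) : set 'cV[R]_2 :=
  segment p.1 (p.1 + e_ p.2).
(* (W, a^* ) is parallel to e_b and (W, b^* ) is parallel to e_a. *)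
Definition elem_dual_strand (p : point * letter) : set 'cV[R]_2 :=
  segment p.1 (p.1 + e_ (swap_letter p.2)).

Definition fsum_union (S : fsum) : set 'cV[R]_2 :=
  \bigcup_(p in [set` S]) elem_strand p.
Definition dual_fsum_union (S : fsum) : set 'cV[R]_2 :=
  \bigcup_(p in [set` S]) elem_dual_strand p.

Definition strand_space (sigma : substitution) : set lattice_path :=
  [set g | strand g /\ forall (m : int) (n : nat),
     exists (W : point) (x : letter) (k : nat),
       strand_trace g m n `<=` fsum_union (iter k (E1 sigma) [:: (W, x)])].

Definition dual_strand_space (sigma : substitution) : set lattice_path :=
  [set g | dual_strand g /\ forall (m : int) (n : nat),
     exists (W : point) (x : letter) (k : nat),
       strand_trace g m n `<=`
         dual_fsum_union (iter k (E1dual sigma) [:: (W, x)])].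

(* [w] is the coding of the finite dual strand whose segments are those of the
   formal sum [S]. *)
Definition is_dual_coding (S : fsum) (w : word) : Prop :=
  exists g : lattice_path,
    (forall k : nat, (k < size w)%N ->
       g (k%:Z + 1) - g k%:Z = dstep (nth la w k)) /\
    strand_trace g 0 (size w) = dual_fsum_union S.

(* For [sigma] primitive and invertible, [E1dual sigma [:: (0, x)]] is a finite
   dual strand, hence has a unique coding. *)
Definition dual_subst (sigma : substitution) : substitution := fun x =>
  xget [::] [set w | is_dual_coding (E1dual sigma [:: (0, x)]) w].

End Strands.

Section Tilings.
Variable R : realType.

Definition translate (T : set R) (x : R) : set R := [set y + x | y in T].

(* The prototiles T_1, T_2 are indexed by the letters a, b. *)
Record tile_subst := TileSubst {
  proto : letter -> set R;
  infl : R;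
  digits : letter -> letter -> {fset R} }.

Definition digit_mx (D : letter -> letter -> {fset R}) : 'M[int]_2 :=
  \matrix_(i, j) (#|` D i j|)%:Z.

Definition set_equations (D : letter -> letter -> {fset R}) (lam : R)
    (T : letter -> set R) : Prop :=
  forall j, [set lam * y | y in T j] =
    \bigcup_(p in [set p : letter * R | p.2 \in D p.1 j]) translate (T p.1) p.2.

Definition is_tile_subst (s : tile_subst) : Prop :=
  [/\ forall i, exists l r : R, l < r /\ proto s i = `[l, r]%classic,
      1 < infl s,
      set_equations (digits s) (infl s) (proto s) &
      forall j (p q : letter * R), p != q ->
        p.2 \in digits s p.1 j -> q.2 \in digits s q.1 j ->
        interior (translate (proto s p.1) p.2)
          `&` interior (translate (proto s q.1) q.2) = set0].

Definition primitive_tile_subst (s : tile_subst) : Prop :=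
  is_tile_subst s /\ primitive_mx (digit_mx (digits s)).

Definition perron (M : 'M[int]_2) : R :=
  xget 0 [set x : R | eigenvalue (map_mx intr M) x /\
    forall y : R, eigenvalue (map_mx intr M) y -> y <= x].

(* For primitive digit matrices, the solution of the set equations in nonempty
   compact sets is unique. *)
Definition tile_subst_of_digits (D : letter -> letter -> {fset R}) :
    tile_subst :=
  let lam := perron (digit_mx D) in
  TileSubst
    (xget (fun=> set0) [set T : letter -> set R |
       (forall i, T i !=set0 /\ compact (T i)) /\ set_equations D lam T])
    lam D.

(* The pair (i, x) stands for the tile T_i + x, and a set of such pairs for a
   patch of labelled tiles. *)
Definition tile (s : tile_subst) (p : letter * R) : set R :=
  translate (proto s p.1) p.2.

Definition inflate (s : tile_subst) (P : set (letter * R)) : set (letter * R) :=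
  [set q | exists2 p, P p &
     exists2 d, d \in digits s q.1 p.1 & q.2 = infl s * p.2 + d].

Definition supertile (s : tile_subst) (n : nat) (j : letter) : set (set R) :=
  [set tile s p | p in iter n (inflate s) [set (j, 0)]].

Definition is_tiling (s : tile_subst) (t : set (set R)) : Prop :=
  [/\ forall A, t A -> exists p, A = tile s p,
      \bigcup_(A in t) A = [set: R] &
      forall A B, t A -> t B -> A <> B -> interior A `&` interior B = set0].

Definition tiling_space (s : tile_subst) : set (set (set R)) :=
  [set t | is_tiling s t /\ forall F : set (set R), finite_set F -> F `<=` t ->
     exists (n : nat) (j : letter) (x : R),
       F `<=` [set translate A x | A in supertile s n j]].

Definition left_vec (l : R) : 'rV[R]_2 := \row_j (if j == la then 1 else l).

Definition tile_length (sigma : substitution) : R :=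
  xget 0 [set l : R | left_vec l *m map_mx intr (subst_mx sigma) =
    perron (subst_mx sigma) *: left_vec l].

Definition delta (l : R) (w : word) : R :=
  (count_mem la w)%:R + (count_mem lb w)%:R * l.

Definition tile_subst_of (sigma : substitution) : tile_subst :=
  let l := tile_length sigma in
  TileSubst
    (fun i => if i == la then `[0, 1]%classic else `[0, l]%classic)
    (perron (subst_mx sigma))
    (fun i j => [fset x in [seq delta l (take k (sigma j))
       | k <- iota 0 (size (sigma j)) & nth la (sigma j) k == i]]%fset).

Definition conjugate (l : R) : R :=
  xget 0 [set l' : R | l' != l /\ exists p : {poly rat},
    [/\ irreducible_poly p, root (map_poly ratr p) l &
        root (map_poly ratr p) l']].

Definition star (l x : R) : R :=
  xget 0 [set y : R | exists al be : rat,
    x = ratr al + ratr be * l /\ y = ratr al + ratr be * conjugate l].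

(* Here the star map is the conjugation in Q(l). *)
Definition star_dual (l : R) (s : tile_subst) : tile_subst :=
  tile_subst_of_digits (fun i j => [fset star l d | d in digits s j i]%fset).

(* [sigma] reads, from left to right, the tiles of s(T_a) and s(T_b). *)
Definition reads (sigma : substitution) (s : tile_subst) : Prop :=
  forall j, exists ds : seq R,
    [/\ size ds = size (sigma j),
        forall i d, (d \in digits s i j) = ((i, d) \in zip (sigma j) ds) &
        forall k m, (k < m < size (sigma j))%N ->
          forall y z, tile s (nth la (sigma j) k, nth 0 ds k) y ->
                      tile s (nth la (sigma j) m, nth 0 ds m) z -> y <= z].

Definition corresponds (sigma : substitution) (s : tile_subst) : Prop :=
  s = tile_subst_of sigma \/ reads sigma s.

Definition similarity_image (c x : R) (t : set (set R)) : set (set R) :=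
  [set [set c * y + x | y in A] | A in t].

Inductive space :=
  | Hull of set biword
  | Tilings of set (set (set R))
  | Strands of set lattice_path
  | DualStrands of set lattice_path.

Definition hull_equiv (X Y : set biword) : Prop :=
  X = Y \/ X = [set swap_letter \o u | u in Y].

Definition tilings_equiv (X Y : set (set (set R))) : Prop :=
  exists c x : R, 0 < c /\ set_bij X Y (similarity_image c x).

Definition strands_equiv (X Y : set lattice_path) : Prop :=
  codings X = codings Y.

(* Only primitive substitutions are linked (and invertible ones for dual strand
   spaces): these are the ones for which the objects below are meaningful. *)
Inductive space_link : space -> space -> Prop :=
  | link_hull sigma rho :
      nonerasing sigma -> primitive sigma -> nonerasing rho -> primitive rho ->
      hull_equiv (hull sigma) (hull rho) ->
      space_link (Hull (hull sigma)) (Hull (hull rho))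
  | link_tilings s s' :
      primitive_tile_subst s -> primitive_tile_subst s' ->
      tilings_equiv (tiling_space s) (tiling_space s') ->
      space_link (Tilings (tiling_space s)) (Tilings (tiling_space s'))
  | link_hull_tilings sigma s :
      nonerasing sigma -> primitive sigma -> primitive_tile_subst s ->
      corresponds sigma s ->
      space_link (Hull (hull sigma)) (Tilings (tiling_space s))
  | link_hull_strands sigma rho :
      nonerasing sigma -> primitive sigma -> nonerasing rho -> primitive rho ->
      codings (strand_space R rho) = hull sigma ->
      space_link (Hull (hull sigma)) (Strands (strand_space R rho))
  | link_hull_dual_strands sigma rho :
      nonerasing sigma -> primitive sigma ->
      nonerasing rho -> primitive rho -> invertible rho ->
      dual_codings (dual_strand_space R rho) = hull sigma ->
      space_link (Hull (hull sigma)) (DualStrands (dual_strand_space R rho))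
  | link_strands sigma rho :
      nonerasing sigma -> primitive sigma -> nonerasing rho -> primitive rho ->
      strands_equiv (strand_space R sigma) (strand_space R rho) ->
      space_link (Strands (strand_space R sigma))
                 (Strands (strand_space R rho)).

(* Two hulls, two tiling spaces or two strand spaces are compared directly, not
   through the (possibly coarser) generated equivalence relation. *)
Definition space_equiv (X Y : space) : Prop :=
  match X, Y with
  | Hull A, Hull B => hull_equiv A B
  | Tilings A, Tilings B => tilings_equiv A B
  | Strands A, Strands B => strands_equiv A B
  | _, _ => clos_refl_sym_trans space space_link X Y
  end.

End Tilings.

Arguments Hull R _ : clear implicits.
Arguments Strands R _ : clear implicits.
Arguments DualStrands R _ : clear implicits.

(* Main.v *)
From mathcomp Require Import all_boot all_order all_algebra.
From mathcomp Require Import all_classical all_reals all_analysis.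
From Stdlib Require Import Relations.
From mathcomp Require Import finmap zify ring lra.
Require Import Defs.
Set Implicit Arguments.
Unset Strict Implicit.
Unset Printing Implicit Defensive.
Import Order.TTheory GRing.Theory Num.Theory.
Import numFieldNormedType.Exports.
Local Open Scope classical_set_scope.
Local Open Scope ring_scope.

(** The theorem holds because the dual map, the reciprocal substitution and the
    star-dual can all be computed on four elementary substitutions: those which
    fix one letter [x] and insert [x] before, or after, the other letter.

    Every invertible substitution with determinant 1 is a product of elementary
    ones ([invertible_prodsub]).  Indeed let [u] and [v] be the images of the two
    letters.  If they begin with the same letter, a conjugation moves this letter
    to the end, and decreases the length of the common prefix of [uv] and [vu].
    If they begin with distinct letters, then either one is a suffix of the other,
    and the pair is an elementary substitution followed by a shorter pair, or only
    their common suffix cancels in products of [u], [v] and their inverses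
    ([reduced_blocks]), and then [u] and [v] are letters since they generate the
    free group.  This shows that [uv] and [vu] differ by exactly one exchange of
    two adjacent letters.  Conversely a pair with this property can be reduced to
    the pair of letters by removing the shorter word from the longer one, on the
    left or on the right ([standard_descent]).

    On an elementary substitution, inverting and conjugating by [tau_a] gives
    again an elementary substitution ([bar_gen_spec]), and the dual map acts on
    dual strands, up to an affine change of the initial point, as an elementary
    substitution acts on words ([E1dual_gen]).  The two results are exchanged by
    the transposition of the letters.  Both constructions reverse products, so the
    reciprocal substitution is exactly the dual substitution with [a] and [b]
    exchanged ([prodbar_swap], [reciprocal_prodsub], [dual_subst_prodsub]), and
    their hulls correspond.

    Since the linear parts are invertible over the integers, the finite strands,
    or dual strands, generated by a substitution are all the lattice paths coded
    by its iterates.  A unit lattice segment is determined by its midpoint, and an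
    edge of a path by its height, so that a path is contained in another one if
    and only if its coding is a factor of the other coding.  Hence the codings of
    both strand spaces form the hull of the dual substitution
    ([codings_strand_space], [dual_codings_strand_space]).

    Finally, the left eigenvector of the substitution matrix for the contracting
    eigenvalue has coordinates 1 and the conjugate tile length; it projects dual
    strands to tilings by intervals.  The digits of the star-dual are, up to sign,
    scaling and translation, the projections of the dual strand
    [E1dual sigma [:: (0, j)]] ([mem_digits_edge]).  So intervals solve the set
    equations of the star-dual; by contraction there is no other compact solution
    ([set_equations_unique]).  The change of sign means that the star-dual reads
    the mirror image of the dual substitution ([reads_s_star]).  Replacing the
    factors of a product of elementary substitutions one by one by their mirror
    images only conjugates it by words, so the mirror image has the same hull
    ([hull_mirror]). *)

(** * Letters, words and substitutions *)

Lemma letterP (i : letter) : i = la \/ i = lb.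
Proof. by case: i => [[|[|//]] Hi]; [left|right]; apply: val_inj. Qed.

Lemma sum_letters (V : nmodType) (F : letter -> V) :
  \sum_(i : letter) F i = F la + F lb.
Proof.
by rewrite !big_ord_recl big_ord0 addr0; congr (_ + F _); apply: val_inj.
Qed.

Lemma point_eq (P Q : point) : P la 0 = Q la 0 -> P lb 0 = Q lb 0 -> P = Q.
Proof. by move=> Ha Hb; apply/colP => i; case: (letterP i) => ->. Qed.

Lemma swap_letterK : involutive swap_letter.
Proof. by move=> x; case: (letterP x) => ->. Qed.

Lemma subst_word_cat sigma u v :
  subst_word sigma (u ++ v) = subst_word sigma u ++ subst_word sigma v.
Proof. by rewrite /subst_word map_cat flatten_cat. Qed.

Lemma subst_word1 sigma x : subst_word sigma [:: x] = sigma x.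
Proof. by rewrite /subst_word /= cats0. Qed.

Lemma subst_word_cons sigma x w :
  subst_word sigma (x :: w) = sigma x ++ subst_word sigma w.
Proof. by []. Qed.

Lemma subst_word_rev sigma w :
  subst_word (rev \o sigma) (rev w) = rev (subst_word sigma w).
Proof.
elim: w => //= x w IHw.
by rewrite rev_cons -cats1 subst_word_cat IHw subst_word1 /= rev_cat.
Qed.

(** The composition of substitutions: [tau] is applied first. *)
Definition subst_comp (sigma tau : substitution) : substitution :=
  fun x => subst_word sigma (tau x).

Lemma subst_word_comp sigma tau w :
  subst_word (subst_comp sigma tau) w = subst_word sigma (subst_word tau w).
Proof.
by elim: w => //= x w IHw; rewrite !subst_word_cons subst_word_cat IHw.
Qed.

Lemma iter_subst_cat sigma n u v :
  iter n (subst_word sigma) (u ++ v) =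
  iter n (subst_word sigma) u ++ iter n (subst_word sigma) v.
Proof. by elim: n => //= n ->; rewrite subst_word_cat. Qed.

Lemma cat_prefix (T : eqType) (u v p q : seq T) :
  u ++ v = p ++ q -> (size u <= size p)%N -> p = u ++ drop (size u) p.
Proof.
move=> E le; rewrite -[LHS](cat_take_drop (size u)); congr (_ ++ _).
by have := congr1 (take (size u)) E; rewrite take_size_cat // takel_cat.
Qed.

Lemma cat_suffix (T : eqType) (u v p q : seq T) :
  u ++ v = p ++ q -> (size v <= size q)%N ->
  q = take (size q - size v) q ++ v.
Proof.
move=> E le; have := congr1 size E; rewrite !size_cat => Es.
rewrite -[LHS](cat_take_drop (size q - size v)); congr (_ ++ _).
have := congr1 (drop (size u)) E; rewrite drop_size_cat // drop_cat.
have -> : (size u < size p)%N = false by lia.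
by have -> : (size u - size p = size q - size v)%N by lia.
Qed.

Lemma catsI (T : eqType) (u v w : seq T) : u ++ v = u ++ w -> v = w.
Proof. by move/eqP; rewrite eqseq_cat // eqxx => /eqP. Qed.

Lemma catIs (T : eqType) (u v w : seq T) : v ++ u = w ++ u -> v = w.
Proof.
by move/(congr1 rev); rewrite !rev_cat => /catsI /(congr1 rev); rewrite !revK.
Qed.

(** The positions at which a letter occurs in a word. *)
Definition occurrences (i : letter) (w : word) : seq nat :=
  [seq k <- iota 0 (size w) | nth la w k == i].

Lemma occurrences_split i w k : k \in occurrences i w ->
  w = take k w ++ i :: drop k.+1 w.
Proof.
rewrite mem_filter mem_iota /= => /andP[/eqP <- lt].
by rewrite -drop_nth // cat_take_drop.
Qed.

Lemma mem_occurrences i u v : size u \in occurrences i (u ++ i :: v).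
Proof.
rewrite mem_filter mem_iota /= nth_cat ltnn subnn eqxx size_cat /=.
by rewrite addnS ltnS leq_addr.
Qed.

Lemma size_occurrences i w : size (occurrences i w) = count_mem i w.
Proof.
rewrite size_filter -[in RHS](mkseq_nth la w) /mkseq count_map.
by apply: eq_count => k.
Qed.

(** An occurrence of [i] in an image lies in the image of one letter. *)
Lemma subst_word_split sigma X u i v : subst_word sigma X = u ++ i :: v <->
  exists X1 j X2 u' v', [/\ X = X1 ++ j :: X2, sigma j = u' ++ i :: v',
    u = subst_word sigma X1 ++ u' & v = v' ++ subst_word sigma X2].
Proof.
split=> [|[X1 [j [X2 [u' [v' [-> Ej -> ->]]]]]]]; last first.
  by rewrite subst_word_cat subst_word_cons Ej /= -!catA.
elim: X u => [|x X IHX] u; first by case: u.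
rewrite subst_word_cons => E.
have [le_u|lt_u] := leqP (size (sigma x)) (size u).
  have Eu := cat_prefix E le_u.
  move: E; rewrite Eu -catA => /eqP; rewrite eqseq_cat // eqxx /= => /eqP.
  case/IHX=> X1 [j [X2 [u' [v' [-> Ej -> ->]]]]].
  by exists (x :: X1), j, X2, u', v'; rewrite subst_word_cons -catA.
have Ex := cat_prefix (esym E) (ltnW lt_u).
move: E; rewrite Ex -catA => /eqP; rewrite eqseq_cat // eqxx /= => /eqP.
case Ed: (drop (size u) (sigma x)) => [|i' v'].
  by move/(congr1 size): Ed; rewrite size_drop /=; lia.
case=> Ei <-; rewrite Ei in Ed; exists [::], x, X, u, v'.
by rewrite {1}Ex Ed.
Qed.

(** * Abelianization *)

Lemma abel_cat u v : abel (u ++ v) = abel u + abel v.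
Proof. by apply/colP => i; rewrite !mxE count_cat PoszD. Qed.

Lemma abel1 x : abel [:: x] = e_ x.
Proof.
by apply/colP => i; rewrite !mxE /= addn0 eqxx andbT eq_sym; case: eqP.
Qed.

Lemma abel_nil : abel [::] = 0.
Proof. by apply/colP => i; rewrite !mxE. Qed.

Lemma abel_cons x w : abel (x :: w) = e_ x + abel w.
Proof. by rewrite -cat1s abel_cat abel1. Qed.

Lemma mulmx_e_ (M : 'M[int]_2) x : M *m e_ x = col x M.
Proof. by rewrite colE. Qed.

Lemma abel_subst sigma w :
  abel (subst_word sigma w) = subst_mx sigma *m abel w.
Proof.
elim: w => [|x w IHw]; first by rewrite abel_nil mulmx0.
rewrite subst_word_cons abel_cat IHw abel_cons mulmxDr; congr (_ + _).
by rewrite mulmx_e_; apply/colP => i; rewrite !mxE.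
Qed.

Lemma subst_mx_comp sigma tau :
  subst_mx (subst_comp sigma tau) = subst_mx sigma *m subst_mx tau.
Proof.
apply/matrixP => i j; have := abel_subst sigma (tau j).
move/(congr1 (fun A : 'cV[int]_2 => A i 0)); rewrite !mxE => ->.
by apply: eq_bigr => k _; rewrite !mxE.
Qed.

Lemma abel_iter sigma n w :
  abel (iter n (subst_word sigma) w) = (subst_mx sigma ^+ n) *m abel w.
Proof.
elim: n => [|n IHn] /=; first by rewrite expr0 mul1mx.
by rewrite abel_subst IHn exprS mulmxA.
Qed.

Lemma primitiveP sigma : primitive sigma <->
  exists n, forall i j, i \in iter n (subst_word sigma) [:: j].
Proof.
have E n i j : (0 < (subst_mx sigma ^+ n) i j) =
    (i \in iter n (subst_word sigma) [:: j]).
  have := abel_iter sigma n [:: j]; rewrite abel1 mulmx_e_.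
  move/(congr1 (fun A : 'cV[int]_2 => A i 0)); rewrite !mxE => <-.
  by rewrite ltz_nat -has_pred1 has_count.
by split=> -[n Hn]; exists n => i j; rewrite ?E // -E.
Qed.

Lemma primitive_eq_mx sigma tau : subst_mx sigma = subst_mx tau ->
  primitive sigma -> primitive tau.
Proof. by rewrite /primitive => ->. Qed.

(** * The four elementary substitutions *)

(** The name of an elementary substitution: a letter, and the side on which it is
    inserted. *)
Definition gen := (letter * bool)%type.

(** [gsub (x, s)] fixes the letter [x] and inserts [x] next to the other letter:
    before it if [s = false], after it if [s = true]. *)
Definition gsub (g : gen) : substitution := fun y =>
  if y == g.1 then [:: y] else if g.2 then [:: y; g.1] else [:: g.1; y].

(** The composition of a list of elementary substitutions; the last one is applied
    first. *)
Definition prodsub (gs : seq gen) : substitution :=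
  foldr (fun g tau => subst_comp (gsub g) tau) (fun x => [:: x]) gs.

Lemma subst_id w : subst_word (fun x => [:: x]) w = w.
Proof. by elim: w => //= x w IHw; rewrite subst_word_cons IHw. Qed.

Lemma prodsub_cat gs hs w :
  subst_word (prodsub (gs ++ hs)) w =
  subst_word (prodsub gs) (subst_word (prodsub hs) w).
Proof.
elim: gs w => [|g gs IHgs] w /=; first by rewrite subst_id.
by rewrite !subst_word_comp IHgs.
Qed.

Lemma prodsub_cons g gs w :
  subst_word (prodsub (g :: gs)) w =
  subst_word (gsub g) (subst_word (prodsub gs) w).
Proof. exact: subst_word_comp. Qed.

Lemma prodsub_rcons gs g w :
  subst_word (prodsub (rcons gs g)) w =
  subst_word (prodsub gs) (subst_word (gsub g) w).
Proof. by rewrite -cats1 prodsub_cat prodsub_cons subst_id. Qed.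

Lemma nonerasing_word sigma w : nonerasing sigma -> w != [::] ->
  subst_word sigma w != [::].
Proof.
move=> ne; case: w => // x w _; rewrite subst_word_cons.
by case: (sigma x) (ne x).
Qed.

Lemma nonerasing_gsub g : nonerasing (gsub g).
Proof. by move=> y; rewrite /gsub; case: ifP => // _; case: ifP. Qed.

Lemma nonerasing_prodsub gs : nonerasing (prodsub gs).
Proof.
by elim: gs => [//|g gs IH] x; apply: nonerasing_word => //; exact: nonerasing_gsub.
Qed.

(** * Substitutions whose values on ab and ba differ by one transposition *)

(** The products [uv] and [vu] differ by one exchange of the adjacent letters [x]
    and [y]. *)
Definition standard (u v : word) (x y : letter) : Prop :=
  exists p q, u ++ v = p ++ [:: x; y] ++ q /\ v ++ u = p ++ [:: y; x] ++ q.

Lemma standard_sym u v x y : standard u v x y -> standard v u y x.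
Proof. by case=> p [q [H1 H2]]; exists p, q. Qed.

Lemma standard_nonnil u v x y : x != y -> standard u v x y -> u != [::].
Proof.
move=> xy [p [q [H1 H2]]]; apply/eqP => u0; move: H1; rewrite u0 /= => H1.
move: H2; rewrite u0 cats0 H1 => /eqP; rewrite eqseq_cat // eqxx /=.
by rewrite eqseq_cons (negPf xy).
Qed.

(** Unless both words are letters, the shorter one is a prefix or a suffix of the
    longer one, and dividing it out preserves the property. *)
Lemma standard_descent u v x y : x != y -> standard u v x y ->
  (size u <= size v)%N ->
  [\/ u = [:: x] /\ v = [:: y],
      exists2 v', v = u ++ v' & standard u v' x y |
      exists2 v', v = v' ++ u & standard u v' x y].
Proof.
move=> xy [p [q [H1 H2]]] le_uv.
have := congr1 size H1; rewrite !size_cat /= => Hs.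
have [le_p|lt_p] := leqP (size u) (size p).
  have Ep := cat_prefix H1 le_p; set p' := drop _ p in Ep.
  rewrite Ep -!catA in H1 H2.
  have Ev := cat_prefix (esym H2) le_uv; set v' := drop _ v in Ev.
  apply: Or32; exists v' => //; exists p', q.
  split; first by apply: (@catsI _ u); rewrite -Ev.
  by apply: (@catsI _ u); rewrite [LHS]catA -Ev.
have [le_q|lt_q] := leqP (size u) (size q).
  rewrite catA in H2; have Eq := cat_suffix H2 le_q.
  set q' := take _ q in Eq.
  rewrite Eq !catA in H1 H2.
  have Ev := cat_suffix (esym H1) le_uv; set v' := take _ v in Ev.
  apply: Or33; exists v' => //; exists p, q'.
  split; apply: (@catIs _ u); last by rewrite -Ev H2 !catA.
  by rewrite -catA -Ev H1 !catA.
(* Now u is longer than p and q, so size u = size v = size p + 1 = size q + 1. *)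
have Eu : u = rcons p x.
  have := congr1 (take (size u)) H1; rewrite take_size_cat // => ->.
  have -> : size u = size (rcons p x) by rewrite size_rcons; lia.
  by rewrite -[p ++ _]cat_rcons take_size_cat.
have Ev : v = y :: q.
  by apply: (@catsI _ u); rewrite H1 Eu cat_rcons.
have Ev' : v = rcons p y.
  have := congr1 (take (size v)) H2; rewrite take_size_cat // => ->.
  have -> : size v = size (rcons p y) by rewrite size_rcons; lia.
  by rewrite -[p ++ _]cat_rcons take_size_cat.
have Eu' : u = x :: q.
  by apply: (@catsI _ v); rewrite H2 Ev' cat_rcons.
case: p {H1 H2 lt_p Hs} Eu Ev' => [|z p] /= Eu Ev'; first exact: Or31.
by case/eqP: xy; move: Ev Eu'; rewrite Ev' Eu => -[<- _] [<- _].
Qed.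

Lemma substP (sigma tau : substitution) :
  sigma la = tau la -> sigma lb = tau lb -> sigma = tau.
Proof. by move=> Ha Hb; apply/funext => i; case: (letterP i) => ->. Qed.

(** Right composition with an elementary substitution. *)
Lemma subst_comp_gsub tau x s : subst_comp tau (gsub (x, s)) =
  (fun y => if y == x then tau x
            else if s then tau y ++ tau x else tau x ++ tau y).
Proof.
apply/funext => y; rewrite /subst_comp /gsub /=.
case: eqP => [->|_]; first by rewrite subst_word1.
by case: s; rewrite !subst_word_cons /= cats0.
Qed.

(** Dividing out the shorter word is the removal of an elementary substitution on
    the right. *)
Lemma standard_prodsub_size n sigma : standard (sigma la) (sigma lb) la lb ->
  (size (sigma la) + size (sigma lb) <= n)%N -> exists gs, sigma = prodsub gs.
Proof.
elim: n sigma => [|n IHn] sigma st len.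
  have := standard_nonnil (isT : la != lb) st.
  by case: (sigma la) len.
have na := standard_nonnil (isT : la != lb) st.
have nb := standard_nonnil (isT : lb != la) (standard_sym st).
have pa : (0 < size (sigma la))%N by rewrite lt0n size_eq0.
have pb : (0 < size (sigma lb))%N by rewrite lt0n size_eq0.
have step tau g : sigma = subst_comp tau (gsub g) ->
    standard (tau la) (tau lb) la lb ->
    (size (tau la) + size (tau lb) <= n)%N -> exists gs, sigma = prodsub gs.
  move=> Es st' le; have [gs Et] := IHn _ st' le.
  exists (rcons gs g); rewrite Es; apply/funext => x.
  by rewrite -[RHS]subst_word1 prodsub_rcons subst_word1 Et.
have [le|lt] := leqP (size (sigma la)) (size (sigma lb)).
  case: (standard_descent (isT : la != lb) st le) => [[Ea Eb]|[v Ev st']|[v Ev st']].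
  - by exists [::]; apply: substP; rewrite ?Ea ?Eb.
  - apply: (step (fun i => if i == la then sigma la else v) (la, false)) => //.
      by rewrite subst_comp_gsub; apply: substP.
    by move: len; rewrite Ev /= size_cat; lia.
  - apply: (step (fun i => if i == la then sigma la else v) (la, true)) => //.
      by rewrite subst_comp_gsub; apply: substP.
    by move: len; rewrite Ev /= size_cat; lia.
case: (standard_descent (isT : lb != la) (standard_sym st) (ltnW lt)) =>
  [[Ea Eb]|[v Ev st']|[v Ev st']].
- by exists [::]; apply: substP; rewrite ?Ea ?Eb.
- apply: (step (fun i => if i == lb then sigma lb else v) (lb, false)) => /=.
  + by rewrite subst_comp_gsub; apply: substP.
  + exact: standard_sym.
  + by move: len; rewrite Ev /= size_cat; lia.
- apply: (step (fun i => if i == lb then sigma lb else v) (lb, true)) => /=.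
  + by rewrite subst_comp_gsub; apply: substP.
  + exact: standard_sym.
  + by move: len; rewrite Ev /= size_cat; lia.
Qed.

Lemma standard_prodsub sigma : standard (sigma la) (sigma lb) la lb ->
  exists gs, sigma = prodsub gs.
Proof. by move=> st; apply: standard_prodsub_size st (leqnn _). Qed.

(** * Determinants *)

Lemma det2 (K : comNzRingType) (A : 'M[K]_2) :
  \det A = A la la * A lb lb - A la lb * A lb la.
Proof.
rewrite (expand_det_row _ ord0) !big_ord_recl big_ord0 /cofactor !det_mx11.
rewrite !mxE /= /bump /= expr0 expr1 mul1r addr0 mulN1r mulrN.
by congr (_ * A _ _ - A _ _ * A _ _); apply: val_inj.
Qed.

Lemma det_gsub g : \det (subst_mx (gsub g)) = 1.
Proof. by rewrite det2 !mxE; case: g => x []; case: (letterP x) => ->. Qed.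

Lemma det_prodsub gs : \det (subst_mx (prodsub gs)) = 1.
Proof.
elim: gs => [|g gs IH] /=.
  rewrite -[RHS](det1 _ 2); congr (\det _); apply/matrixP => i j.
  by case: (letterP i) (letterP j) => -> [] ->; rewrite !mxE.
by rewrite subst_mx_comp det_mulmx det_gsub IH mulr1.
Qed.

Lemma det_swap sigma :
  \det (subst_mx (sigma \o swap_letter)) = - \det (subst_mx sigma).
Proof.
by rewrite !det2 !mxE /=; ring.
Qed.

(** * The free group *)

Section FreeGroup.
Local Open Scope group_scope.

(** The value of a signed generator under the morphism which extends [f]. *)
Definition signed_val (f : letter -> F2) (x : signed_letter) : F2 :=
  if x.2 then (f x.1)^-1 else f x.1.

Lemma signed_val_sinv f x : signed_val f (sinv x) = (signed_val f x)^-1.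
Proof. by case: x => i [] //=; rewrite /signed_val /= invgK. Qed.

Lemma prod_reduce f w :
  \prod_(x <- reduce w) signed_val f x = \prod_(x <- w) signed_val f x.
Proof.
elim: w => //= x w IHw; rewrite big_cons -IHw.
rewrite -/(reduce w); case: (reduce w) => [|y w'] /=; first by rewrite !big_cons.
by case: eqP => [->|_]; rewrite !big_cons // signed_val_sinv mulVKg.
Qed.

Lemma F2_extM f g h : F2_ext f (g * h) = F2_ext f g * F2_ext f h.
Proof. by rewrite /F2_ext prod_reduce big_cat. Qed.

Lemma F2_ext1 f : F2_ext f 1 = 1.
Proof. by rewrite /F2_ext /= big_nil. Qed.

Lemma F2_extV f g : F2_ext f g^-1 = (F2_ext f g)^-1.
Proof.
by apply: (mulgI (F2_ext f g)); rewrite -F2_extM !mulgV F2_ext1.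
Qed.

Lemma F2_ext_gen f i : F2_ext f (F2_gen i) = f i.
Proof. by rewrite /F2_ext big_seq1. Qed.

Lemma F2_ofM u v : F2_of (u ++ v) = F2_of u * F2_of v.
Proof. by apply: val_inj; rewrite /= reduce_catl reduce_catr. Qed.

Lemma F2_of_val g : F2_of (val g) = g.
Proof. by apply: val_inj; rewrite /= reduce_id // (valP g). Qed.

Lemma F2_ofV i : F2_of [:: (i, true)] = (F2_gen i)^-1.
Proof. by apply: val_inj. Qed.

Lemma F2_word_cat u v : F2_word (u ++ v) = F2_word u * F2_word v.
Proof. by rewrite /F2_word map_cat F2_ofM. Qed.

Lemma F2_word_cons i w : F2_word (i :: w) = F2_gen i * F2_word w.
Proof. by rewrite -cat1s F2_word_cat. Qed.

Lemma reduced_pos (w : word) : reduced [seq (i, false) | i <- w].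
Proof.
by case: w => //= x w; elim: w x => //= y w IHw x; rewrite IHw andbT; case: eqP.
Qed.

Lemma val_F2_word w : val (F2_word w) = [seq (i, false) | i <- w].
Proof. exact: reduce_id (reduced_pos w). Qed.

Lemma F2_word_inj : injective F2_word.
Proof.
move=> u v /(congr1 val); rewrite !val_F2_word => /inj_map; apply.
by move=> x y [].
Qed.

Lemma F2_end_word sigma w : F2_end sigma (F2_word w) = F2_word (subst_word sigma w).
Proof.
elim: w => [|x w IHw]; first by rewrite /F2_end F2_ext1.
by rewrite F2_word_cons /F2_end F2_extM F2_ext_gen subst_word_cons F2_word_cat -IHw.
Qed.

(** Two group morphisms which agree on the generators are equal. *)
Lemma F2_hom_eq (phi psi : F2 -> F2) :
  {morph phi : g h / g * h} -> {morph psi : g h / g * h} ->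
  (forall i, phi (F2_gen i) = psi (F2_gen i)) -> phi =1 psi.
Proof.
move=> Hphi Hpsi E g; rewrite -(F2_of_val g).
have one chi : {morph chi : g h / (g * h : F2)} -> chi 1 = 1 :> F2.
  by move=> Hchi; apply: (mulgI (chi 1)); rewrite -Hchi !mulg1.
have inv chi : {morph chi : g h / (g * h : F2)} ->
    forall h, chi h^-1 = (chi h)^-1 :> F2.
  by move=> Hchi h; apply: (mulgI (chi h)); rewrite -Hchi !mulgV one.
elim: (val g) => [|[i b] w IHw]; first by rewrite !one.
rewrite -cat1s F2_ofM Hphi Hpsi IHw; congr (_ * _).
by case: b; rewrite ?F2_ofV ?inv ?E.
Qed.

Lemma F2_end_comp sigma tau g :
  F2_end (subst_comp sigma tau) g = F2_end sigma (F2_end tau g).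
Proof.
move: g; apply: F2_hom_eq => [g h|g h|i]; rewrite /F2_end ?F2_extM //.
by rewrite !F2_ext_gen -/(F2_end _ _) F2_end_word.
Qed.

(** [sigma la] and [sigma lb] generate the free group. *)
Definition generating (sigma : substitution) : Prop :=
  forall g, exists h, F2_end sigma h = g.

Lemma generating_comp sigma tau :
  generating (subst_comp sigma tau) -> generating sigma.
Proof.
by move=> S g; have [h <-] := S g; exists (F2_end tau h); rewrite F2_end_comp.
Qed.

(** Moving a common first letter to the end is a conjugation. *)
Lemma generating_conj sigma tau x :
  (forall i, F2_word (sigma i) = F2_gen x * F2_word (tau i) * (F2_gen x)^-1) ->
  generating sigma -> generating tau.
Proof.
move=> E S g; have [h Eh] := S (F2_gen x * g * (F2_gen x)^-1).
exists h; apply: (mulgI (F2_gen x)); apply: (mulIg (F2_gen x)^-1).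
rewrite -Eh; move: h {Eh}; apply: F2_hom_eq => [h k|h k|i].
- by rewrite /F2_end F2_extM -!mulgA mulKg.
- by rewrite /F2_end F2_extM.
- by rewrite /F2_end !F2_ext_gen -E.
Qed.

Lemma generating_noncomm sigma : generating sigma ->
  sigma la ++ sigma lb <> sigma lb ++ sigma la.
Proof.
move=> S E.
have comm i j : commute (F2_word (sigma i)) (F2_word (sigma j)).
  rewrite /commute -!F2_word_cat.
  by case: (letterP i) => ->; case: (letterP j) => ->; rewrite ?E.
have comm1 h j : commute (F2_end sigma h) (F2_word (sigma j)).
  apply/commute_sym; rewrite /F2_end /F2_ext; apply: big_ind.
  - exact: commute1.
  - by move=> x y; apply: commuteM.
  - by move=> [i []] _ //=; first apply/commuteV.
have comm2 h k : commute (F2_end sigma h) (F2_end sigma k).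
  rewrite {2}/F2_end /F2_ext; apply: big_ind.
  - exact: commute1.
  - by move=> x y; apply: commuteM.
  - by move=> [i []] _ //=; first apply/commuteV.
have [ha Ea] := S (F2_gen la); have [hb Eb] := S (F2_gen lb).
have := comm2 ha hb; rewrite /commute Ea Eb => /(congr1 val).
by [].
Qed.

(** * Reduced products *)

(** A word and its inverse, as words in signed letters. *)
Notation pos w := [seq (i : letter, false) | i <- w].
Notation neg w := (rev [seq (i : letter, true) | i <- w]).

Lemma F2_of_neg (w : word) : F2_of (neg w) = (F2_word w)^-1.
Proof.
have -> : (F2_word w)^-1 = F2_of (rev (map sinv (val (F2_word w)))) by [].
by rewrite val_F2_word -map_comp.
Qed.

Let d0 : signed_letter := (la, false).

(** Only the junction can prevent a product of reduced words from being reduced;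
    [d0] is an irrelevant default value, both words being nonempty. *)
Lemma reduced_cat u v : reduced u -> reduced v -> u != [::] -> v != [::] ->
  head d0 v != sinv (last d0 u) -> reduced (u ++ v).
Proof.
case/lastP: u => // u x; case: v => // y v; rewrite /reduced /= last_rcons.
move=> ru rv _ _ xy; case: u ru => [|z u] /=; first by rewrite rv xy.
by rewrite cat_path last_rcons /= xy => ->.
Qed.

Lemma reduced_neg (w : word) : reduced (neg w).
Proof.
rewrite /reduced rev_sorted; case: w => //= x w.
by elim: w x => //= y w IHw x; rewrite IHw andbT; case: eqP.
Qed.

Lemma head_pos (w : word) r : w != [::] -> head d0 (pos w ++ r) = (head la w, false).
Proof. by case: w. Qed.
Lemma last_pos (w : word) r : w != [::] -> last d0 (r ++ pos w) = (last la w, false).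
Proof.
by case/lastP: w => // w x _; rewrite map_rcons last_cat !last_rcons.
Qed.
Lemma head_neg (w : word) r : w != [::] -> head d0 (neg w ++ r) = (last la w, true).
Proof.
by case/lastP: w => // w x _; rewrite map_rcons rev_rcons last_rcons.
Qed.
Lemma last_neg (w : word) r : w != [::] -> last d0 (r ++ neg w) = (head la w, true).
Proof. by case: w => // x w _; rewrite /= rev_cons last_cat last_rcons. Qed.
Lemma cat_nil2 (T : eqType) (u v w : seq T) : v != [::] -> u ++ v ++ w != [::].
Proof. by case: u => //; case: v. Qed.
Lemma pos_nil (w : word) : w != [::] -> pos w != [::].
Proof. by case: w. Qed.
Lemma neg_nil (w : word) : w != [::] -> neg w != [::].
Proof. by case/lastP: w => // w x _; rewrite map_rcons rev_rcons. Qed.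

Lemma sinv_same_sign (i j : letter) b : (i, b) != sinv (j, b).
Proof. by apply/eqP => -[_]; case: b. Qed.

Lemma cat_nil1 (T : eqType) (u v : seq T) : u != [::] -> u ++ v != [::].
Proof. by case: u. Qed.

(** A pair of words [sigma la], [sigma lb] with common suffix [s], whose remaining
    prefixes [u1 la] and [u1 lb] differ in their first and in their last letters. *)
Section Blocks.
Variables (sigma u1 : substitution) (s : word).
Hypothesis sigmaE : forall i, sigma i = u1 i ++ s.
Hypothesis u1_ne : nonerasing u1.
Hypothesis head_u1 : forall i j, i != j -> head la (u1 i) != head la (u1 j).
Hypothesis last_u1 : forall i j, i != j -> last la (u1 i) != last la (u1 j).

(** Since the blocks [u1 i] begin and end with distinct letters, only copies of
    [s] cancel in a product of [sigma la], [sigma lb] and their inverses, and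
    each factor contributes at least one letter. *)
Lemma reduced_blocks g : reduced g ->
  if g is (i, b) :: g' then exists r, let w :=
      if b then neg s ++ neg (u1 i) ++ r else pos (u1 i) ++ r in
    [/\ F2_end sigma (F2_of g) = F2_of w, reduced w & (size g' <= size r)%N]
  else True.
Proof.
elim: g => // -[i b] g IHg ig.
have Ei : F2_end sigma (F2_of [:: (i, b)]) =
    F2_of (if b then neg s ++ neg (u1 i) else pos (u1 i) ++ pos s).
  have E : F2_end sigma (F2_gen i) = F2_word (u1 i ++ s).
    by rewrite /F2_end F2_ext_gen sigmaE.
  case: b {ig}; last by rewrite -map_cat.
  rewrite F2_ofV /F2_end F2_extV -/(F2_end _ _) E -F2_of_neg.
  by rewrite map_cat rev_cat.
have red_neg k : reduced (neg s ++ neg (u1 k)).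
  by rewrite -rev_cat -map_cat; apply: reduced_neg.
have red_pos k : reduced (pos (u1 k) ++ pos s).
  by rewrite -map_cat; apply: reduced_pos.
case: g IHg ig => [_ _|[j c] g IHg ijg].
  by case: b Ei => Ei; [exists [::]|exists (pos s)]; split; rewrite ?cats0.
have [r' /= [Er redr le]] := IHg (path_sorted ijg).
have {ijg IHg} ij : (j, c) != sinv (i, b) by case/andP: ijg.
rewrite -cat1s F2_ofM /F2_end F2_extM -!/(F2_end _ _) Er Ei.
have size1 (w : word) : w != [::] -> (0 < size w)%N by case: w.
have sj := size1 _ (u1_ne j).
have sr : size (neg s ++ neg (u1 j) ++ r') = (size s + size (u1 j) + size r')%N.
  by rewrite !size_cat !size_rev !size_map addnA.
have ne_neg k r : neg s ++ neg (u1 k) ++ r != [::].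
  by apply: cat_nil2; apply: neg_nil.
have ne_pos k r : pos (u1 k) ++ r != [::].
  by apply: (@cat_nil2 _ [::]); apply: pos_nil.
case: b c ij Er redr {Ei} => -[] /= ij Er redr.
- exists (neg s ++ neg (u1 j) ++ r').
  split; [by rewrite -F2_ofM -!catA|rewrite catA|rewrite sr; lia].
  apply: reduced_cat => //; first by have := ne_neg i [::]; rewrite cats0.
  by rewrite last_neg // catA -rev_cat -map_cat head_neg ?cat_nil1 //
       sinv_same_sign.
- have {}ij : i != j by apply: contraNneq ij => ->.
  exists (pos (u1 j) ++ r').
  split; [by rewrite -F2_ofM -!catA|rewrite catA|].
    apply: reduced_cat => //; first by have := ne_neg i [::]; rewrite cats0.
    rewrite last_neg // head_pos //.
    by apply: contraNneq (head_u1 ij) => -[] ->.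
  by rewrite size_cat size_map; lia.
- have {}ij : i != j by rewrite eq_sym; apply: contraNneq ij => ->.
  exists (neg (u1 j) ++ r').
  have redr' : reduced (neg (u1 j) ++ r').
    exact: (cat_sorted2 redr).2.
  split.
  + by rewrite !F2_ofM (F2_of_neg s) -!mulgA (mulVKg (F2_word s)).
  + apply: reduced_cat => //; first exact: reduced_pos.
    * exact: pos_nil.
    * by apply: (@cat_nil2 _ [::]); apply: neg_nil.
    rewrite head_neg // (last_pos [::]) //.
    by apply: contraNneq (last_u1 ij) => -[] ->.
  + by rewrite size_cat size_rev size_map; lia.
- exists (pos s ++ pos (u1 j) ++ r').
  split; [by rewrite -F2_ofM -!catA|rewrite catA|].
    apply: reduced_cat => //.
    by rewrite -map_cat (last_pos [::]) ?cat_nil1 // head_pos // sinv_same_sign.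
  by rewrite !size_cat !size_map; lia.
Qed.

(** A generator can only be the image of a single positive generator: any other
    nontrivial reduced word has an image of length at least two or one beginning
    with an inverse letter. *)
Lemma reduced_blocks_letter x : generating sigma ->
  exists i, sigma i = [:: x].
Proof.
move=> S; have [g Eg] := S (F2_gen x); have rg := valP g; rewrite -(F2_of_val g) in Eg.
case: (val g) rg Eg => [_|[i b] w rw].
  by rewrite /F2_end F2_ext1 => /(congr1 val).
case: (reduced_blocks rw) => r /= [Er rr le] Eg; exists i.
have E : (if b then neg s ++ neg (u1 i) ++ r else pos (u1 i) ++ r) =
    [:: (x, false)].
  by move: Eg; rewrite Er => /(congr1 val); rewrite /= reduce_id.
case: b rr rw Er Eg E => _ rw _ Eg E.
  have := congr1 (head d0) E; rewrite catA -rev_cat -map_cat head_neg //=.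
  exact: cat_nil1.
have w0 : w = [::].
  apply: size0nil; have := congr1 size E; rewrite size_cat size_map /=.
  have : (0 < size (u1 i))%N by rewrite lt0n size_eq0 u1_ne.
  by lia.
move: Eg; rewrite w0 /F2_end F2_ext_gen => Eg.
by apply: F2_word_inj; rewrite Eg.
Qed.

End Blocks.

(** The longest common suffix of two words. *)
Lemma common_suffix (u v : word) : exists u1 v1 s, [/\ u = u1 ++ s, v = v1 ++ s &
  [\/ u1 = [::], v1 = [::] | last la u1 != last la v1]].
Proof.
elim/last_ind: u v => [|u x IHu] v.
  by exists [::], v, [::]; rewrite !cats0; split=> //; apply: Or31.
case/lastP: v => [|v y].
  by exists (rcons u x), [::], [::]; rewrite !cats0; split=> //; apply: Or32.
have [->|xy] := eqVneq x y; last first.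
  exists (rcons u x), (rcons v y), [::]; rewrite !cats0; split=> //.
  by apply: Or33; rewrite !last_rcons.
have [u1 [v1 [s [-> -> H]]]] := IHu v; exists u1, v1, (rcons s y).
by rewrite !rcons_cat.
Qed.

(** * Generating pairs of words are standard *)

(** The images of the letters form a standard pair, in one of the two orders of the
    exchanged letters. *)
Definition standardizable (sigma : substitution) : Prop :=
  exists x y, x != y /\ standard (sigma la) (sigma lb) x y.

(** The inductive step when the images begin with distinct letters. *)
Lemma distinct_heads_standard n sigma :
  (forall tau, nonerasing tau -> generating tau ->
     (size (tau la) + size (tau lb) <= n)%N -> standardizable tau) ->
  nonerasing sigma -> generating sigma ->
  (size (sigma la) + size (sigma lb) <= n.+1)%N ->
  head la (sigma la) != head la (sigma lb) -> standardizable sigma.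
Proof.
move=> IHn ne S len hd.
have pos_size i : (0 < size (sigma i))%N by rewrite lt0n size_eq0 ne.
have pa := pos_size la; have pb := pos_size lb.
have [u1 [v1 [s [Ea Eb]]]] := common_suffix (sigma la) (sigma lb).
move=> lst.
have [u1_0|u1_ne] := eqVneq u1 [::]; last have [v1_0|v1_ne] := eqVneq v1 [::].
- pose tau (i : letter) := if i == la then sigma la else v1.
  have Es : sigma = subst_comp tau (gsub (la, true)).
    by rewrite subst_comp_gsub; apply: substP; rewrite /tau //= Eb Ea u1_0.
  have v1_ne' : v1 != [::].
    by apply: contraNneq hd => v1_0; rewrite Ea Eb u1_0 v1_0.
  have [|||x [y [xy [p [q [H1 H2]]]]]] := IHn tau.
  + by move=> i; rewrite /tau; case: ifP.
  + by apply: (@generating_comp _ (gsub (la, true))); rewrite -Es.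
  + have := congr1 size Eb; rewrite size_cat /tau /=.
    by have := congr1 size Ea; rewrite u1_0 /=; lia.
  exists x, y; split=> //; exists p, (q ++ sigma la).
  rewrite /tau /= in H1 H2.
  have Eb' : sigma lb = v1 ++ sigma la by rewrite Eb Ea u1_0.
  by rewrite Eb' catA H1 -catA H2 -!catA.
- pose tau (i : letter) := if i == lb then sigma lb else u1.
  have Es : sigma = subst_comp tau (gsub (lb, true)).
    by rewrite subst_comp_gsub; apply: substP; rewrite /tau //= Ea Eb v1_0.
  have u1_ne' : u1 != [::].
    by apply: contraNneq hd => u1_0; rewrite Ea Eb u1_0 v1_0.
  have [|||x [y [xy [p [q [H1 H2]]]]]] := IHn tau.
  + by move=> i; rewrite /tau; case: ifP.
  + by apply: (@generating_comp _ (gsub (lb, true))); rewrite -Es.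
  + have := congr1 size Ea; rewrite size_cat /tau /=.
    by have := congr1 size Eb; rewrite v1_0 /=; lia.
  exists x, y; split=> //; exists p, (q ++ sigma lb).
  rewrite /tau /= in H1 H2.
  have Ea' : sigma la = u1 ++ sigma lb by rewrite Ea Eb v1_0.
  by rewrite Ea'; split; [rewrite H1 -!catA|rewrite catA H2 -!catA].
have {}lst : last la u1 != last la v1.
  by case: lst => [E|E|//]; move: u1_ne v1_ne; rewrite E.
pose w (i : letter) := if i == la then u1 else v1.
have w_ne : nonerasing w by move=> i; rewrite /w; case: ifP.
have sw i : sigma i = w i ++ s by case: (letterP i) => ->.
have hw i j : i != j -> head la (w i) != head la (w j).
  have : head la u1 != head la v1.
    by move: hd; rewrite Ea Eb; case: (u1) u1_ne => // ? ? _; case: (v1) v1_ne.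
  by case: (letterP i) => ->; case: (letterP j) => -> //= H _; rewrite eq_sym.
have lw i j : i != j -> last la (w i) != last la (w j).
  by move: lst; case: (letterP i) => ->; case: (letterP j) => -> //= H _; rewrite eq_sym.
have [i Ei] := reduced_blocks_letter sw w_ne hw lw la S.
have [j Ej] := reduced_blocks_letter sw w_ne hw lw lb S.
have ij : i != j by apply/eqP => Eij; move: Ei; rewrite Eij Ej.
case: (letterP i) Ei ij => ->; case: (letterP j) Ej => -> // Ej Ei _.
- by exists la, lb; split=> //; exists [::], [::]; rewrite Ei Ej.
- by exists lb, la; split=> //; exists [::], [::]; rewrite Ei Ej.
Qed.

Lemma generating_standard_size n sigma : nonerasing sigma -> generating sigma ->
  (size (sigma la) + size (sigma lb) <= n)%N -> standardizable sigma.
Proof.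
elim: n sigma => [|n IHn] sigma ne S len.
  by have := ne la; case: (sigma la) len.
have [k neq_k] : exists k, nth la (sigma la ++ sigma lb) k !=
                           nth la (sigma lb ++ sigma la) k.
  apply: contrapT => /forallNP E; apply: (generating_noncomm S).
  apply: (@eq_from_nth _ la); first by rewrite !size_cat addnC.
  by move=> k _; apply/eqP/negPn/negP/E.
(* As long as both images begin with the same letter, conjugate by it: the first
   position where the two products differ decreases. *)
elim: k sigma ne S len neq_k => [|k IHk] sigma ne S len neq_k.
  apply: (distinct_heads_standard IHn) => //; move: neq_k.
  by case: (sigma la) (ne la) => // ? ? _; case: (sigma lb) (ne lb).
have [hd|] := eqVneq (head la (sigma la)) (head la (sigma lb)); last first.
  exact: (distinct_heads_standard IHn).
have [x [u [v [Ea Eb]]]] : exists x u v, sigma la = x :: u /\ sigma lb = x :: v.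
  move: hd; case: (sigma la) (ne la) => // x u _; case: (sigma lb) (ne lb) => //= y v _ <-.
  by exists x, u, v.
pose tau (i : letter) := if i == la then rcons u x else rcons v x.
have rcons_ne (w : word) : rcons w x != [::] by case: w.
have [||||y [z [yz [p [q []]]]]] := IHk tau.
- by move=> i; rewrite /tau; case: ifP.
- apply: (@generating_conj sigma tau x) S => i.
  by case: (letterP i) => ->; rewrite ?Ea ?Eb /tau /= F2_word_cons
    -cats1 F2_word_cat -!mulgA mulgV mulg1.
- by move: len; rewrite Ea Eb /tau /= !size_rcons.
- move: neq_k; rewrite Ea Eb /tau /= !cat_rcons -2!rcons_cons -!rcons_cat !nth_rcons.
  have -> : size (v ++ x :: u) = size (u ++ x :: v).
    by rewrite !size_cat /= !addnS addnC.
  have [//|le_k] := ltnP k (size (u ++ x :: v)).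
  rewrite !nth_default ?eqxx //.
  by move: le_k; rewrite !size_cat /= !addnS addnC.
rewrite /tau /= !cat_rcons -2!rcons_cons -!rcons_cat => H1 H2.
exists y, z; split=> //; case/lastP: q H1 H2 => [|q t].
  rewrite -!cats1 => /(congr1 (last la)) + /(congr1 (last la)).
  by rewrite !last_cat /= => Exz Exy; move: yz; rewrite -Exz -Exy eqxx.
rewrite -!rcons_cons -!rcons_cat => /rcons_inj[H1 _] /rcons_inj[H2 _].
by exists (x :: p), q; rewrite Ea Eb /= H1 H2.
Qed.

End FreeGroup.

(** Two words generating the free group form, up to their order, the image of
    the alphabet under a product of elementary substitutions; the order is
    detected by the determinant. *)
Theorem invertible_prodsub sigma : nonerasing sigma -> invertible sigma ->
  \det (subst_mx sigma) = 1 -> exists gs, sigma = prodsub gs.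
Proof.
move=> ne [f _ fK] det1.
have S : generating sigma by move=> g; exists (f g).
have [x [y [xy st]]] := generating_standard_size ne S (leqnn _).
case: (letterP x) xy st => ->; case: (letterP y) => -> // _ st.
  exact: standard_prodsub st.
have [|gs Es] := @standard_prodsub (sigma \o swap_letter).
  exact: standard_sym st.
by have := det_swap sigma; rewrite Es det_prodsub det1.
Qed.

(** * The reciprocal substitution *)

Section Reciprocal.
Local Open Scope group_scope.

(** The reciprocal of an elementary substitution: the side is exchanged when the
    inserted letter is [b]. *)
Definition bar_gen (g : gen) : gen := (g.1, if g.1 == la then g.2 else ~~ g.2).

(** Taking reciprocals reverses products. *)
Definition prodbar (gs : seq gen) := prodsub (rev (map bar_gen gs)).

Lemma tau_aM : {morph tau_a : g h / g * h}.
Proof. exact: F2_extM. Qed.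

Lemma tau_a_gen i :
  tau_a (F2_gen i) = if i == la then (F2_gen i)^-1 else F2_gen i.
Proof. exact: F2_ext_gen. Qed.

Lemma tau_aK : involutive tau_a.
Proof.
apply: F2_hom_eq => [g h|//|i] /=; first by rewrite !tau_aM.
by case: (letterP i) => ->; rewrite !tau_a_gen //= /tau_a F2_extV F2_ext_gen invgK.
Qed.

Lemma F2_inverseK f : injective f -> cancel f (F2_inverse f).
Proof.
move=> inj g; have := @pinvKV _ _ (fun=> 1) [set: F2] f; apply; rewrite ?in_setT //.
by move=> x y _ _; apply: inj.
Qed.

Lemma bar_gen_spec g i :
  F2_end (gsub g) (tau_a (F2_word (gsub (bar_gen g) i))) = tau_a (F2_gen i).
Proof.
have Eg j : F2_word [:: j] = F2_gen j by [].
case: g => x s; case: (letterP x) => ->; case: s; case: (letterP i) => ->;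
 rewrite /bar_gen /gsub /=; rewrite ?(F2_word_cons _ [:: _]) ?Eg ?tau_aM ?tau_a_gen /=;
 rewrite /F2_end ?F2_extM ?F2_extV ?F2_ext_gen /=;
 rewrite ?(F2_word_cons _ [:: _]) ?Eg ?invgM ?invgK ?mulgK ?mulgVK ?mulKg ?mulVKg
   ?mulVg ?mulgV ?mul1g ?mulg1 //.
Qed.

(** This identity says that [tau_a] conjugates [prodbar gs] to the inverse of
    [prodsub gs]. *)
Lemma prodbar_spec gs w :
  F2_end (prodsub gs) (tau_a (F2_word (subst_word (prodbar gs) w))) =
  tau_a (F2_word w).
Proof.
elim: gs w => [|g gs IHgs] w.
  rewrite /prodbar /= subst_id.
  have : F2_end (prodsub [::]) =1 id.
    apply: F2_hom_eq => [g h|//|i]; first by rewrite /F2_end F2_extM.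
    by rewrite /F2_end F2_ext_gen.
  by move->.
rewrite /prodbar map_cons rev_cons prodsub_rcons -/(prodbar gs).
rewrite [prodsub (g :: gs)]/= F2_end_comp IHgs.
elim: w => [|i w IHw].
  by rewrite /tau_a /F2_end !F2_ext1.
rewrite subst_word_cons F2_word_cat tau_aM /F2_end F2_extM.
by rewrite -!/(F2_end _ _) IHw bar_gen_spec F2_word_cons tau_aM.
Qed.

Lemma reciprocal_prodsub gs : invertible (prodsub gs) ->
  reciprocal (prodsub gs) = prodbar gs.
Proof.
move=> inv; apply/funext => x.
have H : F2_word (prodbar gs x) = (tau_a \o F2_inverse (F2_end (prodsub gs))
    \o F2_inverse tau_a) (F2_gen x).
  have E : F2_inverse tau_a (F2_gen x) = tau_a (F2_gen x).
    by rewrite -{1}[F2_gen x]tau_aK (F2_inverseK (inv_inj tau_aK)).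
  rewrite /= E.
  have <- : F2_end (prodsub gs) (tau_a (F2_word (prodbar gs x))) = tau_a (F2_gen x).
    by rewrite -[prodbar gs x]subst_word1 prodbar_spec.
  by rewrite (F2_inverseK (bij_inj inv)) tau_aK.
by apply: xget_unique => // w Ew; apply: F2_word_inj; rewrite H.
Qed.

End Reciprocal.

(** * The dual substitution as a product of elementary ones *)

(** The substitution [sigma] with the letters [a] and [b] exchanged. *)
Definition swap_sub (sigma : substitution) : substitution :=
  fun x => map swap_letter (sigma (swap_letter x)).

(** The dual of an elementary substitution; it is its reciprocal with the letters
    exchanged. *)
Definition dual_gen (g : gen) : gen := (swap_letter g.1, (bar_gen g).2).

(** Duality also reverses products. *)
Definition proddual (gs : seq gen) := prodsub (rev (map dual_gen gs)).

Lemma subst_word_swap sigma w : subst_word (swap_sub sigma) w =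
  map swap_letter (subst_word sigma (map swap_letter w)).
Proof.
by elim: w => //= x w IHw; rewrite !subst_word_cons IHw map_cat.
Qed.

Lemma iter_subst_swap sigma n w : iter n (subst_word (swap_sub sigma)) w =
  map swap_letter (iter n (subst_word sigma) (map swap_letter w)).
Proof.
elim: n => [|n IHn] /=; first by rewrite (mapK swap_letterK).
by rewrite IHn subst_word_swap (mapK swap_letterK).
Qed.

Lemma gsub_swap x s : gsub (swap_letter x, s) = swap_sub (gsub (x, s)).
Proof.
by apply/funext => i; rewrite /swap_sub /gsub /=; case: s;
  case: (letterP x) => ->; case: (letterP i) => ->.
Qed.

Lemma prodbar_swap gs : prodbar gs = swap_sub (proddual gs).
Proof.
rewrite /prodbar /proddual -!map_rev; elim: (rev gs) => [|g hs IH] /=.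
  by apply/funext => i; case: (letterP i) => ->.
rewrite IH; apply/funext => i; rewrite /subst_comp {2}/swap_sub.
rewrite (gsub_swap g.1 (bar_gen g).2) subst_word_swap.
by rewrite (mapK swap_letterK).
Qed.

Lemma subst_mx_dual_gen g : subst_mx (gsub (dual_gen g)) = (subst_mx (gsub g))^T.
Proof.
apply/matrixP => i j; rewrite !mxE; case: g => x s.
by case: (letterP x) => ->; case: s; case: (letterP i) => ->; case: (letterP j) => ->.
Qed.

Lemma subst_mx_id : subst_mx (fun x => [:: x]) = 1%:M.
Proof.
apply/matrixP => i j; rewrite !mxE.
by case: (letterP i) => ->; case: (letterP j) => ->.
Qed.

Lemma eq_subst_word sigma tau : (forall w, subst_word sigma w = subst_word tau w) ->
  sigma = tau.
Proof. by move=> E; apply/funext => x; rewrite -[LHS]subst_word1 E subst_word1. Qed.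

Lemma subst_mx_proddual gs : subst_mx (proddual gs) = (subst_mx (prodsub gs))^T.
Proof.
elim: gs => [|g gs IHgs]; first by rewrite subst_mx_id trmx1.
rewrite [prodsub _]/= subst_mx_comp trmx_mul -IHgs -subst_mx_dual_gen -subst_mx_comp.
congr subst_mx; apply: eq_subst_word => w.
by rewrite /proddual map_cons rev_cons prodsub_rcons subst_word_comp.
Qed.

Lemma trmx_exp (M : 'M[int]_2) n : M^T ^+ n = (M ^+ n)^T.
Proof.
elim: n => [|n IHn]; first by rewrite !expr0 trmx1.
by rewrite exprS IHn exprSr; apply/esym/trmx_mul.
Qed.

Lemma primitive_proddual gs : primitive (prodsub gs) -> primitive (proddual gs).
Proof.
case=> n Hn; exists n => i j.
by rewrite subst_mx_proddual trmx_exp mxE.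
Qed.

Lemma primitive_swap sigma : primitive sigma -> primitive (swap_sub sigma).
Proof.
move/primitiveP => [n Hn]; apply/primitiveP; exists n => i j.
rewrite iter_subst_swap -[i]swap_letterK mem_map; first exact: Hn.
exact: inv_inj swap_letterK.
Qed.

(** * Hulls *)

Lemma hull_swap sigma : hull (swap_sub sigma) = [set swap_letter \o u | u in hull sigma].
Proof.
have H tau u : hull tau u -> hull (swap_sub tau) (swap_letter \o u).
  move=> Hu m n; have [x [k /infixP[p [q E]]]] := Hu m n.
  exists (swap_letter x), k; rewrite iter_subst_swap /= swap_letterK E !map_cat.
  by rewrite -map_comp infix_infix.
apply/seteqP; split=> [u Hu|_ [u Hu <-]]; last exact: H.
exists (swap_letter \o u); last first.
  by apply/funext => k; rewrite /= swap_letterK.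
have := H _ _ Hu; congr (hull _ _); apply/funext => x.
by rewrite /swap_sub swap_letterK (mapK swap_letterK).
Qed.

Lemma size_iter_subst sigma k w : nonerasing sigma ->
  (size w <= size (iter k (subst_word sigma) w))%N.
Proof.
move=> ne; elim: k => //= k IHk; apply: (leq_trans IHk).
elim: (iter _ _ _) => //= z t IHt; rewrite subst_word_cons size_cat.
by have := ne z; case: (sigma z) => //= ? ? _; lia.
Qed.

(** Every letter has arbitrarily long extensions on both sides in the language of
    a primitive substitution. *)
Lemma language_extend sigma x n : nonerasing sigma -> primitive sigma ->
  exists u v y k, [/\ iter k (subst_word sigma) [:: y] = u ++ x :: v,
    (n <= size u)%N & (n <= size v)%N].
Proof.
move=> ne /primitiveP[K HK].
have dbl w : (2 * size w <= size (iter K (subst_word sigma) w))%N.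
  elim: w => //= z w IHw; rewrite -cat1s iter_subst_cat size_cat.
  have := HK la z; have := HK lb z.
  by case: (iter K _ [:: z]) => // i [|j t] /=; [rewrite !inE => /eqP <-|lia].
have [k [y Hk]] : exists k y, (n + n < size (iter k (subst_word sigma) [:: y]))%N.
  elim: (n + n)%N => [|i [k [y Hk]]]; first by exists 0%N, x.
  exists (K + k)%N, y; rewrite iterD.
  by have := dbl (iter k (subst_word sigma) [:: y]); lia.
have : (n < size (drop n (iter k (subst_word sigma) [:: y])))%N.
  by rewrite size_drop; lia.
have sz : size (take n (iter k (subst_word sigma) [:: y])) = n.
  by rewrite size_takel //; lia.
case Ed: (drop n _) => [//|z w] /= nw.
have [u [v E]] : exists u v, iter K (subst_word sigma) [:: z] = u ++ x :: v.
  by have := HK x z; case/splitPr => u v; exists u, v.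
set t := take n _ in sz.
exists (iter K (subst_word sigma) t ++ u), (v ++ iter K (subst_word sigma) w), y, (K + k)%N.
split; last 2 first.
- by rewrite size_cat; have := size_iter_subst K t ne; lia.
- by rewrite size_cat; have := size_iter_subst K w ne; lia.
rewrite iterD -[X in iter K _ X](cat_take_drop n) Ed -/t -[z :: w]cat1s.
by rewrite !iter_subst_cat E -!catA.
Qed.

(** A conjugation by a word [w] iterates to conjugations by words. *)
Lemma conj_iter sigma rho w k :
  (forall X, w ++ subst_word rho X = subst_word sigma X ++ w) ->
  exists wk, forall X, wk ++ iter k (subst_word rho) X =
    iter k (subst_word sigma) X ++ wk.
Proof.
move=> conj; elim: k => [|i [wi IH]]; first by exists [::] => X; rewrite cats0.
exists (subst_word sigma wi ++ w) => X /=.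
by rewrite -catA conj catA -subst_word_cat IH subst_word_cat catA.
Qed.

(** Primitive substitutions conjugate by a word have the same hull: the iterate of
    a letter under one of them occurs, shifted by the length of the conjugating
    word, in the iterate of a long word under the other one. *)
Lemma hull_conj sigma rho w : nonerasing sigma -> primitive sigma ->
  nonerasing rho -> primitive rho ->
  (forall X, w ++ subst_word rho X = subst_word sigma X ++ w) ->
  hull rho = hull sigma.
Proof.
move=> nes ps ner pr conj; apply/seteqP; split=> g Hg m n.
  have [x [k Hk]] := Hg m n; have [wk Hwk] := conj_iter k conj.
  have [u [v [y [l [El _ le]]]]] := language_extend x (size wk) nes ps.
  exists y, (k + l)%N; rewrite iterD El iter_subst_cat.
  apply: infix_catl; apply: (infix_trans Hk).
  have := Hwk (x :: v); rewrite -cat1s !iter_subst_cat catA => E.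
  have Hx := congr1 size (Hwk [:: x]); rewrite !size_cat in Hx.
  have sz := leq_trans le (size_iter_subst k v nes).
  rewrite (cat_prefix E) -?catA; first exact: infix_infix.
  by rewrite !size_cat Hx leq_add2l.
have [x [k Hk]] := Hg m n; have [wk Hwk] := conj_iter k conj.
have [u [v [y [l [El le _]]]]] := language_extend x (size wk) ner pr.
exists y, (k + l)%N; rewrite iterD El -cat1s catA iter_subst_cat.
apply: infix_catr; apply: (infix_trans Hk).
have := Hwk (u ++ [:: x]); rewrite !iter_subst_cat -catA => E.
have Hx := congr1 size (Hwk [:: x]); rewrite !size_cat in Hx.
have sz := leq_trans le (size_iter_subst k u ner).
rewrite (cat_suffix (esym E)); first exact: infix_infix.
by rewrite !size_cat -Hx leq_add2r.
Qed.

(** * Mirror images *)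

(** The mirror image reverses the image of each letter. *)
Definition mirror (sigma : substitution) : substitution := rev \o sigma.

(** The same letter inserted on the other side. *)
Definition mirror_gen (g : gen) : gen := (g.1, ~~ g.2).

Lemma gsub_mirror g : mirror (gsub g) = gsub (mirror_gen g).
Proof.
apply/funext => x; case: g => y s; rewrite /mirror /gsub /=.
by case: eqP => //; case: s.
Qed.

Lemma mirror_prodsub gs : mirror (prodsub gs) = prodsub (map mirror_gen gs).
Proof.
elim: gs => // g gs IH; rewrite [prodsub (map _ _)]/= -IH -gsub_mirror.
by apply/funext => x; rewrite /subst_comp /mirror /= subst_word_rev.
Qed.

(** The two elementary substitutions which insert [x] are conjugate by [x]. *)
Lemma gsub_conj x X :
  [:: x] ++ subst_word (gsub (x, true)) X = subst_word (gsub (x, false)) X ++ [:: x].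
Proof.
elim: X => //= y X IH; rewrite !subst_word_cons -catA -IH /gsub /=.
by case: eqP => // ->.
Qed.

Lemma subst_mx_mirror sigma : subst_mx (mirror sigma) = subst_mx sigma.
Proof. by apply/matrixP => i j; rewrite !mxE /mirror /= count_rev. Qed.

Lemma subst_mx_mirror_gen gs g hs :
  subst_mx (prodsub (gs ++ g :: hs)) = subst_mx (prodsub (gs ++ mirror_gen g :: hs)).
Proof.
have E k : prodsub (gs ++ k :: hs) =
    subst_comp (prodsub gs) (subst_comp (gsub k) (prodsub hs)).
  apply: eq_subst_word => w.
  by rewrite prodsub_cat prodsub_cons !subst_word_comp.
by rewrite !E !subst_mx_comp -gsub_mirror subst_mx_mirror.
Qed.

(** Exchanging one factor of a product with its mirror image is a conjugation. *)
Lemma hull_prodsub_mirror_gen gs g hs : primitive (prodsub (gs ++ g :: hs)) ->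
  hull (prodsub (gs ++ g :: hs)) = hull (prodsub (gs ++ mirror_gen g :: hs)).
Proof.
move=> pr.
have pr' := primitive_eq_mx (subst_mx_mirror_gen gs g hs) pr.
case: g pr pr' => x [] pr pr'; [|apply/esym];
  apply: (hull_conj (w := subst_word (prodsub gs) [:: x])) => //;
  try exact: nonerasing_prodsub; move=> X;
  by rewrite !prodsub_cat !prodsub_cons -!subst_word_cat gsub_conj.
Qed.

Lemma hull_mirror gs : primitive (prodsub gs) ->
  hull (mirror (prodsub gs)) = hull (prodsub gs).
Proof.
rewrite mirror_prodsub => pr.
suff H hs : primitive (prodsub (hs ++ gs)) ->
  hull (prodsub (hs ++ map mirror_gen gs)) = hull (prodsub (hs ++ gs)).
  exact: (H [::]).
elim: gs hs {pr} => //= g gs IH hs pr.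
rewrite (hull_prodsub_mirror_gen pr) -!cat_rcons; apply: IH.
rewrite cat_rcons; apply: primitive_eq_mx pr; exact: subst_mx_mirror_gen.
Qed.
(** * Lattice paths with prescribed steps *)

Section Paths.
Variable st : letter -> point.

(** The edges of the path which starts at [P] and is coded by [w]; an edge is
    given by its initial vertex and the letter of its step. *)
Fixpoint edges (P : point) (w : word) : seq (point * letter) :=
  if w is i :: w' then (P, i) :: edges (P + st i) w' else [::].

(** The vector from the initial to the final vertex of a path coded by [w]. *)
Definition displacement (w : word) : point := \sum_(i <- w) st i.

Lemma displacement_cat u v : displacement (u ++ v) = displacement u + displacement v.
Proof. by rewrite /displacement big_cat. Qed.

Lemma displacement_cons i w : displacement (i :: w) = st i + displacement w.
Proof. by rewrite /displacement big_cons. Qed.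

Lemma edges_cat P u v :
  edges P (u ++ v) = edges P u ++ edges (P + displacement u) v.
Proof.
elim: u P => [|i u IHu] P /=; first by rewrite /displacement big_nil addr0.
by rewrite IHu displacement_cons addrA.
Qed.

Lemma size_edges P w : size (edges P w) = size w.
Proof. by elim: w P => //= i w IHw P; rewrite IHw. Qed.

Lemma nth_edges P w k : (k < size w)%N ->
  nth (0, la) (edges P w) k = (P + displacement (take k w), nth la w k).
Proof.
elim: w P k => //= i w IHw P [|k] /=.
  by rewrite /displacement big_nil addr0.
by rewrite ltnS => /IHw ->; rewrite displacement_cons addrA.
Qed.

Lemma map_snd_edges P w : map snd (edges P w) = w.
Proof. by elim: w P => //= i w IHw P; rewrite IHw. Qed.

Lemma edges_infix_sub P u w v :
  {subset edges (P + displacement u) w <= edges P (u ++ w ++ v)}.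
Proof. by move=> p pw; rewrite !edges_cat !mem_cat pw orbT. Qed.

(** A height function which increases by one at each step locates the edges. *)
Variable h : point -> int.
Hypothesis hD : {morph h : P Q / P + Q}.
Hypothesis h_st : forall i, h (st i) = 1.

Lemma height0 : h 0 = 0.
Proof. by apply: (@addrI _ (h 0)); rewrite -hD !addr0. Qed.

Lemma height_displacement w : h (displacement w) = (size w)%:Z.
Proof.
elim: w => [|i w IHw]; first by rewrite /displacement big_nil height0.
by rewrite displacement_cons hD IHw h_st.
Qed.

Lemma mem_edgesP P w p : p \in edges P w ->
  exists2 k, (k < size w)%N & p = (P + displacement (take k w), nth la w k) /\
    h p.1 = h P + k%:Z.
Proof.
move/(nthP (0, la)) => [k]; rewrite size_edges => lt <-; exists k => //.
by rewrite nth_edges // hD height_displacement size_takel // ltnW.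
Qed.

(** A path whose edges are edges of another path is a subpath of it. *)
Lemma edges_sub_infix P w Q w' :
  {subset edges P w <= edges Q w'} -> infix w w'.
Proof.
case: (posnP (size w)) => [/size0nil -> _|w0 sub]; first exact: infix0s.
have mem k : (k < size w)%N -> exists2 k', (k' < size w')%N &
    nth la w k = nth la w' k' /\ h P + k%:Z = h Q + k'%:Z.
  move=> lt; have := @mem_nth _ (0, la) (edges P w) k.
  rewrite size_edges nth_edges // => /(_ lt) /sub/mem_edgesP[k' lt' [[E1 E2] hE]].
  exists k' => //; split=> //; rewrite -hE /= hD height_displacement.
  by rewrite size_takel // ltnW.
have [k0 lt0 [_ E0]] := mem 0%N w0.
have H k : (k < size w)%N -> (k0 + k < size w')%N /\ nth la w k = nth la w' (k0 + k).
  move=> lt; have [k' lt' [-> Ek]] := mem k lt.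
  by have -> : (k0 + k = k')%N by lia.
have Ew : w = take (size w) (drop k0 w').
  have le : (size w <= size (drop k0 w'))%N.
    by rewrite size_drop; have [|+ _] := H (size w).-1; lia.
  apply: (@eq_from_nth _ la); first by rewrite size_takel.
  by move=> k lt; rewrite nth_take // nth_drop; have [] := H k lt.
rewrite -(cat_take_drop k0 w') -[drop k0 w'](cat_take_drop (size w)) -Ew.
exact: infix_infix.
Qed.

(** * Traces of paths in the plane *)

Section Trace.
Variable R : realType.

Hypothesis st_unit : forall i, exists j, st i = e_ j \/ st i = - e_ j.
Hypothesis st_parity : forall i j P Q, P *+ 2 + st i = Q *+ 2 + st j -> i = j.

(** The segment, in the plane, of the edge [p]. *)
Definition edge_segment (p : point * letter) : set 'cV[R]_2 :=
  @segment R p.1 (p.1 + st p.2).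

(** The union of the segments of the path from [P] coded by [w]. *)
Definition trace_path (P : point) (w : word) : set 'cV[R]_2 :=
  \bigcup_(p in [set` edges P w]) edge_segment p.

Lemma st_coords i : exists a b : int, [/\ st i la 0 = a, st i lb 0 = b &
  [\/ a = 0 /\ b = 1, a = 0 /\ b = -1, a = 1 /\ b = 0 | a = -1 /\ b = 0]].
Proof.
have [j [E|E]] := st_unit i; exists (st i la 0), (st i lb 0); rewrite E !mxE;
  case: (letterP j) => -> /=; split=> //.
- exact: Or43.
- exact: Or41.
- exact: Or44.
- exact: Or42.
Qed.

(** The midpoint of the segment of the edge [p]. *)
Definition midpoint (p : point * letter) : 'cV[R]_2 :=
  map_mx intr p.1 + 2^-1 *: map_mx intr (st p.2).

Lemma midpoint_edge p : edge_segment p (midpoint p).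
Proof.
exists 2^-1; first by rewrite /= in_itv /=; apply/andP; split; lra.
by rewrite /= (addrC p.1) addrK.
Qed.

(** The midpoint of a unit lattice segment lies on no other such segment. *)
Lemma edge_segment_midpoint p q : edge_segment q (midpoint p) -> p = q.
Proof.
case: p q => [P i] [Q j] [t /= t01 E].
have {}E c : (Q c 0)%:~R + t * (st j c 0)%:~R = (P c 0)%:~R + 2^-1 * (st i c 0)%:~R :> R.
  by move/(congr1 (fun X : 'cV[R]_2 => X c 0)): E; rewrite (addrC Q) addrK !mxE.
have [t0 t1] : 0 <= t /\ t <= 1 by move: t01; rewrite in_itv /= => /andP[].
(* Twice the midpoint of the first edge is an integer point with exactly one odd
   coordinate. Its difference with 2Q is 2t times the step of the second edge: it
   vanishes in one coordinate, which must be the even one, and in the other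
   coordinate it is, up to sign, an odd integer between 0 and 2. *)
have pos2 c : (st j c 0 = 1 -> 0 <= P c 0 * 2 + st i c 0 - Q c 0 * 2 <= 2) /\
  (st j c 0 = -1 -> -2 <= P c 0 * 2 + st i c 0 - Q c 0 * 2 <= 0) /\
  (st j c 0 = 0 -> P c 0 * 2 + st i c 0 - Q c 0 * 2 = 0).
  have Ec : (P c 0 * 2 + st i c 0 - Q c 0 * 2)%:~R = 2 * t * (st j c 0)%:~R :> R.
    have := E c; rewrite !(rmorphD, rmorphM, rmorphN) /=; set x := (Q c 0)%:~R.
    by set y := t * _; move=> H; rewrite -mulrA -/y; lra.
  split; [|split] => H; move: Ec; rewrite H => Ec.
  - by rewrite -(ler0z R) -(ler_int R) Ec mulr1; apply/andP; split; lra.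
  - by rewrite -(lerz0 R) -(ler_int R) Ec mulrN1; apply/andP; split; lra.
  - by apply: (@intr_inj R); rewrite Ec mulr0.
have Emid : P *+ 2 + st i = Q *+ 2 + st j.
  have [pa1 [pa2 pa3]] := pos2 la; have [pb1 [pb2 pb3]] := pos2 lb.
  have [a [b [Ea Eb Hab]]] := st_coords i; have [a' [b' [Ea' Eb' Hab']]] := st_coords j.
  rewrite Ea Ea' in pa1 pa2 pa3; rewrite Eb Eb' in pb1 pb2 pb3.
  apply: point_eq; rewrite !mulr2n !mxE ?Ea ?Eb ?Ea' ?Eb';
  move: (P la 0) (P lb 0) (Q la 0) (Q lb 0) pa1 pa2 pa3 pb1 pb2 pb3 => x y z u;
  clear -Hab Hab'; case: Hab => -[-> ->]; case: Hab' => -[-> ->]; lia.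
have ij := st_parity Emid; congr (_, _) => //.
move: Emid; rewrite ij => /addIr; rewrite !mulr2n => Emid.
have E2 c : P c 0 + P c 0 = Q c 0 + Q c 0.
  by have := congr1 (fun X : point => X c 0) Emid; rewrite !mxE.
by apply: point_eq; [have := E2 la|have := E2 lb]; lia.
Qed.

(** Inclusion of traces is inclusion of edges: the midpoint of an edge of the first
    path lies on an edge of the second one. *)
Lemma trace_path_sub P w Q w' : trace_path P w `<=` trace_path Q w' <->
  {subset edges P w <= edges Q w'}.
Proof.
split=> [sub p pw|sub x [p pw px]]; last by exists p => //; apply: sub.
have [|q qw qp] := sub (midpoint p); first by exists p => //; exact: midpoint_edge.
by rewrite (edge_segment_midpoint qp).
Qed.

(** The trace of a finite part of a lattice path with the given steps. *)
Lemma strand_traceE g m n (u : nat -> letter) :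
  (forall k, (k < n)%N -> g (m + k%:Z + 1) - g (m + k%:Z) = st (u k)) ->
  @strand_trace R g m n = trace_path (g m) (map u (iota 0 n)).
Proof.
move=> Hg.
have Hv k : (k <= n)%N -> g m + displacement (map u (iota 0 k)) = g (m + k%:Z).
  elim: k => [|k IHk] lt; first by rewrite /displacement big_nil !addr0.
  have -> : iota 0 k.+1 = iota 0 k ++ [:: k] by rewrite -[in LHS]addn1 iotaD.
  rewrite map_cat displacement_cat addrA IHk ?(ltnW lt) //.
  rewrite /= /displacement big_seq1 -Hg // addrC subrK.
  by congr g; rewrite -[in RHS]addn1 PoszD addrA.
have He k : (k < n)%N ->
    nth (0, la) (edges (g m) (map u (iota 0 n))) k = (g (m + k%:Z), u k).
  move=> lt; rewrite nth_edges ?size_map ?size_iota // -map_take take_iota.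
  have -> : minn k n = k by apply/minn_idPl/ltnW.
  by rewrite Hv ?(ltnW lt) // (nth_map 0%N) ?size_iota // nth_iota.
have Hs k : (k < n)%N -> @segment R (g (m + k%:Z)) (g (m + k%:Z + 1)) =
    edge_segment (g (m + k%:Z), u k).
  by move=> lt; rewrite /edge_segment /= -Hg // [g (m + k%:Z) + _]addrC subrK.
apply/seteqP; split=> x.
  move=> [k /= lt]; rewrite Hs // => xk; exists (g (m + k%:Z), u k) => //=.
  by rewrite -He // mem_nth // size_edges size_map size_iota.
move=> [p /= /(nthP (0, la))[k]]; rewrite size_edges size_map size_iota => lt <-.
by rewrite He // => xk; exists k => //=; rewrite Hs.
Qed.

(** * Spaces of bi-infinite paths and hulls *)

(** The bi-infinite path through the origin coded by [u]. *)
Definition path_of (u : biword) : lattice_path := fun k =>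
  match k with
  | Posz n => \sum_(i < n) st (u i%:Z)
  | Negz n => - \sum_(i < n.+1) st (u (Negz i))
  end.

Lemma path_of_step u k : path_of u (k + 1) - path_of u k = st (u k).
Proof.
case: k => [n|[|n]].
- have -> : Posz n + 1 = Posz n.+1 by lia.
  by rewrite /= big_ord_recr /= addrAC subrr add0r.
- by rewrite /= big_ord0 big_ord_recr big_ord0 /= !add0r opprK.
- have -> : Negz n.+1 + 1 = Negz n by rewrite !NegzE; lia.
  by rewrite /= opprK [in X in _ + X]big_ord_recr /= addrA addNr add0r.
Qed.

(** Given patches which are exactly the paths coded by the iterates of [rho], the
    bi-infinite paths covered locally by patches are coded by the hull of [rho]. *)
Variable rho : substitution.
Variable patch : point -> letter -> nat -> set 'cV[R]_2.
Hypothesis patch_path : forall W x k, exists P,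
  patch W x k = trace_path P (iter k (subst_word rho) [:: x]).
Hypothesis path_patch : forall P x k, exists W,
  patch W x k = trace_path P (iter k (subst_word rho) [:: x]).

Lemma path_space_hull :
  [set w | exists2 g : lattice_path,
     (forall k, exists i, g (k + 1) - g k = st i) /\
     (forall (m : int) (n : nat), exists (W : point) (x : letter) (k : nat),
       @strand_trace R g m n `<=` patch W x k) &
     forall k, g (k + 1) - g k = st (w k)] = hull rho.
Proof.
apply/seteqP; split=> w.
  move=> [g [_ Hg] gw] m n; have [W [x [k Hk]]] := Hg m n; exists x, k.
  have [P EP] := patch_path W x k; move: Hk.
  rewrite EP (@strand_traceE _ _ _ (fun i => w (m + i%:Z))) => [|i _]; last exact: gw.
  by move/trace_path_sub/edges_sub_infix.
move=> Hw; exists (path_of w); last exact: path_of_step.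
split=> [k|m n]; first by exists (w k); exact: path_of_step.
have [x [k /infixP[a [b E]]]] := Hw m n.
have [W EW] := path_patch (path_of w m - displacement a) x k.
exists W, x, k; rewrite EW (@strand_traceE _ _ _ (fun i => w (m + i%:Z))) => [|i _];
  last exact: path_of_step.
apply/trace_path_sub; rewrite E -{1}[path_of w m](subrK (displacement a)).
exact: edges_infix_sub.
Qed.

End Trace.
End Paths.

(** * Strands *)

Section Strands.
Variable R : realType.

(** The height for strands, whose steps are [e_ la] and [e_ lb]. *)
Definition sum_height (P : point) : int := P la 0 + P lb 0.

Lemma sum_heightD : {morph sum_height : P Q / P + Q}.
Proof. by move=> P Q; rewrite /sum_height !mxE addrACA. Qed.

Lemma sum_height_e_ i : sum_height (e_ i) = 1.
Proof. by rewrite /sum_height !mxE; case: (letterP i) => ->. Qed.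

Lemma e_unit (i : letter) : exists j, e_ i = e_ j \/ e_ i = - e_ j.
Proof. by exists i; left. Qed.

(** Steps are distinct modulo 2, hence determined by the midpoint. *)
Lemma e_parity (i j : letter) (P Q : point) :
  P *+ 2 + e_ i = Q *+ 2 + e_ j -> i = j.
Proof.
move=> E; have := congr1 (fun X : point => X la 0) E.
rewrite !mulr2n !mxE; case: (letterP i) => ->; case: (letterP j) => -> //=; lia.
Qed.

Lemma displacement_abel w : displacement e_ w = abel w.
Proof.
elim: w => [|i w IHw]; first by rewrite abel_nil /displacement big_nil.
by rewrite displacement_cons IHw abel_cons.
Qed.

Lemma E1_edges sigma P w : E1 sigma (edges e_ P w) =
  edges e_ (subst_mx sigma *m P) (subst_word sigma w).
Proof.
elim: w P => //= i w IHw P; rewrite subst_word_cons edges_cat.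
rewrite [LHS](_ : _ = E1 sigma [:: (P, i)] ++ E1 sigma (edges e_ (P + e_ i) w)); last first.
  by rewrite /E1 /= cats0.
rewrite IHw; congr (_ ++ edges _ _ _); last first.
  by rewrite mulmxDr displacement_abel -abel1 -abel_subst subst_word1.
rewrite /E1 /= cats0; apply: (@eq_from_nth _ (0, la)).
  by rewrite size_map size_iota size_edges.
move=> k; rewrite size_map size_iota => lt.
rewrite (nth_map 0%N) ?size_iota // nth_iota // nth_edges //=.
by rewrite displacement_abel.
Qed.

Lemma iter_E1 sigma k P x : iter k (E1 sigma) [:: (P, x)] =
  edges e_ (subst_mx sigma ^+ k *m P) (iter k (subst_word sigma) [:: x]).
Proof.
elim: k => [|k IHk] /=; first by rewrite expr0 mul1mx.
by rewrite IHk E1_edges exprS mulmxA.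
Qed.

Theorem codings_strand_space sigma : \det (subst_mx sigma) = 1 ->
  codings (@strand_space R sigma) = hull sigma.
Proof.
move=> det1.
have patch W x k : fsum_union (iter k (E1 sigma) [:: (W, x)]) =
    @trace_path e_ R (subst_mx sigma ^+ k *m W) (iter k (subst_word sigma) [:: x]).
  by rewrite iter_E1.
apply: (@path_space_hull e_ _ sum_heightD sum_height_e_ R e_unit e_parity sigma
  (fun W x k => fsum_union (iter k (E1 sigma) [:: (W, x)]))) => W x k.
  by eexists; exact: patch.
have U : subst_mx sigma ^+ k \in unitmx.
  by apply: unitrX; rewrite -/(_ \in unitmx) unitmxE det1 unitr1.
by exists (invmx (subst_mx sigma ^+ k) *m W); rewrite patch mulKVmx.
Qed.

(** * Dual strands *)

(** The height for dual strands, whose steps are [- e_ lb] and [e_ la]. *)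
Definition diff_height (P : point) : int := P la 0 - P lb 0.

Lemma diff_heightD : {morph diff_height : P Q / P + Q}.
Proof. by move=> P Q; rewrite /diff_height !mxE opprD addrACA. Qed.

Lemma diff_height_dstep i : diff_height (dstep i) = 1.
Proof. by rewrite /diff_height; case: (letterP i) => ->; rewrite /dstep /= !mxE. Qed.

Lemma dstep_unit (i : letter) : exists j, dstep i = e_ j \/ dstep i = - e_ j.
Proof. by case: (letterP i) => ->; [exists lb; right|exists la; left]. Qed.

Lemma dstep_parity (i j : letter) (P Q : point) :
  P *+ 2 + dstep i = Q *+ 2 + dstep j -> i = j.
Proof.
move=> E; have := congr1 (fun X : point => X la 0) E.
rewrite !mulr2n; case: (letterP i) => ->; case: (letterP j) => -> //=;
  rewrite /dstep !mxE /=; lia.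
Qed.

(** The elementary dual strand which is the edge [p] of a dual strand: the edge
    coded by [a] is traversed downwards, hence ends at the base point. *)
Definition dual_base (p : point * letter) : point * letter :=
  (p.1 - (if p.2 == la then e_ lb else 0), p.2).

(** The formal sum of the dual path from [P] coded by [w]. *)
Definition dual_edges (P : point) (w : word) : fsum :=
  map dual_base (edges dstep P w).

Lemma segmentC (p q : point) : @segment R p q = @segment R q p.
Proof.
have H (x y : point) : @segment R x y `<=` @segment R y x.
  move=> _ [t /= t01 <-]; exists (1 - t).
    by move: t01; rewrite /= !in_itv /= => /andP[? ?]; apply/andP; split; lra.
  by apply/colP => c; rewrite !mxE !rmorphB /=; ring.
by apply/seteqP; split; apply: H.
Qed.

Lemma elem_dual_base p : @elem_dual_strand R (dual_base p) = @edge_segment dstep R p.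
Proof.
case: p => P i; rewrite /elem_dual_strand /edge_segment /dual_base /dstep /=.
case: (letterP i) => -> /=; last by rewrite subr0.
by rewrite subrK segmentC.
Qed.

Lemma dual_union_eqi (S T : fsum) : S =i T ->
  dual_fsum_union S = dual_fsum_union T :> set 'cV[R]_2.
Proof.
by move=> E; apply/seteqP; split=> x [p /= pS px]; exists p => //=; rewrite ?E // -E.
Qed.

Lemma dual_union_edges P w :
  dual_fsum_union (dual_edges P w) = @trace_path dstep R P w.
Proof.
apply/seteqP; split=> x [p /=].
  by move=> /mapP[q qw ->] qx; exists q => //; rewrite -elem_dual_base.
by move=> pw px; exists (dual_base p); rewrite ?elem_dual_base //= map_f.
Qed.

(** Membership in the dual map in terms of factorizations of the images of the
    letters. *)
Lemma mem_E1dual sigma S Q j : subst_mx sigma \in unitmx ->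
  reflect (exists W i u v, [/\ (W, i) \in S, sigma j = u ++ i :: v &
      subst_mx sigma *m Q = W + abel v])
    ((Q, j) \in E1dual sigma S).
Proof.
move=> U; apply: (iffP flatten_mapP).
  move=> [[W i] WS /allpairsPdep[j' [k [_ /occurrences_split Ej [-> ->]]]]].
  exists W, i, (take k (sigma j')), (drop k.+1 (sigma j')); split=> //.
  by rewrite mulKVmx.
move=> [W [i [u [v [WS Ej EQ]]]]]; exists (W, i) => //; apply/allpairsPdep.
exists j, (size u); split.
- by case: (letterP j) => ->.
- by have := mem_occurrences i u v; rewrite /occurrences -Ej.
- congr (_, _); rewrite /= Ej.
  by rewrite -[(size u).+1]addn1 addnC -drop_drop drop_size_cat //= drop0 -EQ mulKmx.
Qed.

Lemma E1dual_eqi sigma S T : subst_mx sigma \in unitmx -> S =i T ->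
  E1dual sigma S =i E1dual sigma T.
Proof.
move=> U E [Q j]; apply/(mem_E1dual _ _ _ U)/(mem_E1dual _ _ _ U);
  by case=> W [i [u [v [WS Ej EQ]]]]; exists W, i, u, v; split; rewrite // ?E // -E.
Qed.

(** The dual map is contravariant. *)
Lemma E1dual_comp sigma tau S :
  subst_mx sigma \in unitmx -> subst_mx tau \in unitmx ->
  E1dual (subst_comp sigma tau) S =i E1dual tau (E1dual sigma S).
Proof.
move=> Us Ut.
have Uc : subst_mx (subst_comp sigma tau) \in unitmx.
  by rewrite subst_mx_comp unitmx_mul Us.
move=> [Q j]; apply/(mem_E1dual _ _ _ Uc)/(mem_E1dual _ _ _ Ut).
  move=> [W [i [u [v [WS]]]]].
  move=> /subst_word_split[X1 [l [X2 [u' [v' [Ej El _ ->]]]]]] EQ.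
  exists (subst_mx tau *m Q - abel X2), l, X1, X2; split; rewrite ?subrK //.
  apply/(mem_E1dual _ _ _ Us); exists W, i, u', v'; split=> //.
  rewrite mulmxBr mulmxA -subst_mx_comp EQ abel_cat abel_subst.
  by rewrite addrA addrK.
move=> [W' [l [X1 [X2 [/(mem_E1dual _ _ _ Us) [W [i [u [v [WS El EW]]]]] Ej EQ]]]]].
exists W, i, (subst_word sigma X1 ++ u), (v ++ subst_word sigma X2); split=> //.
  by apply/subst_word_split; exists X1, l, X2, u, v.
by rewrite subst_mx_comp -mulmxA EQ mulmxDr EW abel_cat abel_subst addrA.
Qed.

Lemma invmxM (A B : 'M[int]_2) : A \in unitmx -> B \in unitmx ->
  invmx (A *m B) = invmx B *m invmx A.
Proof. exact: (@invrM _ A B). Qed.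

Lemma unit_prodsub gs : subst_mx (prodsub gs) \in unitmx.
Proof. by rewrite unitmxE det_prodsub unitr1. Qed.

Lemma unit_gsub g : subst_mx (gsub g) \in unitmx.
Proof. by rewrite unitmxE det_gsub unitr1. Qed.

Lemma invmx_gsub g (X : point) : invmx (subst_mx (gsub g)) *m X =
  \col_i (if i == g.1 then X i 0 - X (swap_letter i) 0 else X i 0).
Proof.
rewrite -[RHS](mulKmx (unit_gsub g)); congr (_ *m _); case: g => x s.
by apply: point_eq; rewrite !mxE sum_letters !mxE /=;
  case: (letterP x) => ->; case: s; rewrite /gsub /swap_letter /=; lia.
Qed.

(** The translation part of the action on dual paths of the dual map of an
    elementary substitution. *)
Definition gen_offset (g : gen) : point := if g.2 then e_ g.1 else 0.

Lemma eq_edge (p : point * letter) (A B : point) (l : letter) :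
  A la 0 = B la 0 -> A lb 0 = B lb 0 -> (p == (A, l)) = (p == (B, l)).
Proof. by move=> Ha Hb; rewrite (point_eq Ha Hb). Qed.

Lemma dual_edges_cons P i w :
  dual_edges P (i :: w) = dual_edges P [:: i] ++ dual_edges (P + dstep i) w.
Proof. by []. Qed.

Lemma dual_edges_cat P u v : dual_edges P (u ++ v) =
  dual_edges P u ++ dual_edges (P + displacement dstep u) v.
Proof. by rewrite /dual_edges edges_cat map_cat. Qed.

Lemma E1dual_cat sigma S T : E1dual sigma (S ++ T) = E1dual sigma S ++ E1dual sigma T.
Proof. by rewrite /E1dual map_cat flatten_cat. Qed.

(** The dual map of [gsub g] acts on dual paths as [gsub (dual_gen g)] acts on
    words: the case of a single edge. *)
Lemma E1dual_gen1 g P i : E1dual (gsub g) (dual_edges P [:: i]) =i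
  dual_edges (invmx (subst_mx (gsub g)) *m P + gen_offset g) (gsub (dual_gen g) i).
Proof.
move=> p; rewrite /E1dual /dual_edges.
case: g => x s; case: (letterP x) => ->; case: s; case: (letterP i) => ->;
 rewrite /= !inE !invmx_gsub ?abel_nil ?abel1 /dual_base /dstep /gen_offset /=.
all: try (apply: eq_edge; rewrite !mxE /=; lia).
all: try (congr (_ || _); apply: eq_edge; rewrite !mxE /=; lia).
all: try (rewrite orbC; congr (_ || _); apply: eq_edge; rewrite !mxE /=; lia).
Qed.

Lemma displacement_dual_gen g i :
  displacement dstep (gsub (dual_gen g) i) = invmx (subst_mx (gsub g)) *m dstep i.
Proof.
rewrite invmx_gsub /displacement; case: g => x s.
by case: (letterP x) => ->; case: s; case: (letterP i) => ->;
  rewrite /gsub /= ?big_cons big_nil; apply: point_eq; rewrite /dstep !mxE /=; lia.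
Qed.

Lemma eqi_cat (T : eqType) (s1 s2 t1 t2 : seq T) :
  s1 =i t1 -> s2 =i t2 -> s1 ++ s2 =i t1 ++ t2.
Proof. by move=> E1 E2 x; rewrite !mem_cat E1 E2. Qed.

(** The images of consecutive edges are consecutive because the linear part maps
    each step to the displacement of its image. *)
Lemma E1dual_gen g P w : E1dual (gsub g) (dual_edges P w) =i
  dual_edges (invmx (subst_mx (gsub g)) *m P + gen_offset g)
             (subst_word (gsub (dual_gen g)) w).
Proof.
elim: w P => // i w IHw P; rewrite subst_word_cons dual_edges_cat.
rewrite dual_edges_cons E1dual_cat; apply: eqi_cat; first exact: E1dual_gen1.
by rewrite displacement_dual_gen addrAC -mulmxDr.
Qed.

Lemma E1dual_id S : E1dual (fun x => [:: x]) S =i S.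
Proof.
have U : subst_mx (fun x => [:: x]) \in unitmx by rewrite subst_mx_id unitmx1.
move=> [Q j]; apply/(mem_E1dual _ _ _ U)/idP => [|QS].
  move=> [W [i [[|? u] [v [WS]]]]]; last by case: u.
  by move=> [-> <-]; rewrite subst_mx_id mul1mx abel_nil addr0 => ->.
by exists Q, j, [::], [::]; rewrite subst_mx_id mul1mx abel_nil addr0.
Qed.

(** The dual map of a product of elementary substitutions acts on dual paths as
    the reversed product of the dual elementary substitutions. *)
Lemma E1dual_prodsub gs : exists c, forall P w,
  E1dual (prodsub gs) (dual_edges P w) =i
  dual_edges (invmx (subst_mx (prodsub gs)) *m P + c) (subst_word (proddual gs) w).
Proof.
elim: gs => [|g gs [c IHgs]].
  exists 0 => P w p.
  by rewrite E1dual_id subst_mx_id invmx1 mul1mx addr0 /proddual subst_id.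
exists (invmx (subst_mx (prodsub gs)) *m gen_offset g + c) => P w p.
have Ut := unit_prodsub gs; have Ug := unit_gsub g.
rewrite (E1dual_comp _ Ug Ut) (E1dual_eqi Ut (E1dual_gen g P w)) IHgs.
rewrite [prodsub (g :: gs)]/= subst_mx_comp.
rewrite invmxM //.
rewrite /proddual map_cons rev_cons prodsub_rcons -/(proddual gs).
by rewrite mulmxDr -!mulmxA addrA.
Qed.

(** The initial vertex of the elementary dual strand based at the origin. *)
Definition dual_start (x : letter) : point := if x == la then e_ lb else 0.

Lemma dual_edges1 W x : [:: (W, x)] = dual_edges (W + dual_start x) [:: x].
Proof. by rewrite /dual_edges /= /dual_base /= addrK. Qed.

Lemma infix_antisym (u v : word) : infix u v -> infix v u -> u = v.
Proof.
move=> /infixP[a [b E]] /infixP[a' [b' E']].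
have /(congr1 size) := E; have /(congr1 size) := E'; rewrite !size_cat => H1 H2.
have a0 : a = [::] by apply: size0nil; lia.
have b0 : b = [::] by apply: size0nil; lia.
by rewrite E a0 b0 cats0.
Qed.

Lemma trace_path_inj P w Q w' :
  @trace_path dstep R P w = @trace_path dstep R Q w' -> w = w'.
Proof.
have sub := @trace_path_sub dstep R dstep_unit dstep_parity.
have inf := edges_sub_infix diff_heightD diff_height_dstep.
move=> E; apply: infix_antisym.
  by apply: (inf P w Q w'); apply/sub; rewrite E.
by apply: (inf Q w' P w); apply/sub; rewrite E.
Qed.

Lemma strand_trace0 (g : lattice_path) w :
  (forall k : nat, (k < size w)%N -> g (k%:Z + 1) - g k%:Z = dstep (nth la w k)) ->
  @strand_trace R g 0 (size w) = @trace_path dstep R (g 0) w.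
Proof.
move=> Hg; rewrite (@strand_traceE dstep _ g 0 (size w) (nth la w)).
  by rewrite -[map _ _]/(mkseq _ _) mkseq_nth.
by move=> k lt; rewrite !add0r Hg.
Qed.

(** A finite dual strand has a unique coding. *)
Lemma dual_codingP P w w' :
  is_dual_coding R (dual_edges P w) w' <-> w' = w.
Proof.
split=> [[g [/strand_trace0 -> E]]|->].
  by apply: (@trace_path_inj (g 0) w' P w); rewrite E dual_union_edges.
exists (fun k => P + path_of dstep (fun z => nth la w `|z|%N) k); split.
  by move=> k _; rewrite opprD addrACA subrr add0r path_of_step.
rewrite strand_trace0 => [|k _]; last first.
  by rewrite opprD addrACA subrr add0r path_of_step.
by rewrite dual_union_edges /= big_ord0 addr0.
Qed.

Lemma is_dual_coding_eqi S T w : S =i T ->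
  is_dual_coding R S w -> is_dual_coding R T w.
Proof. by move=> E [g [Hg tr]]; exists g; rewrite tr (dual_union_eqi E). Qed.

Lemma dual_subst_prodsub gs : dual_subst R (prodsub gs) = proddual gs.
Proof.
have [c Hc] := E1dual_prodsub gs.
apply/funext => x; have Ex := Hc (0 + dual_start x) [:: x].
rewrite -dual_edges1 subst_word1 in Ex.
apply: xget_unique => [|w].
  have Ex' p := esym (Ex p); apply: (is_dual_coding_eqi Ex').
  exact/dual_codingP.
by move/(is_dual_coding_eqi Ex)/dual_codingP.
Qed.

Lemma iter_E1dual gs k : exists c, forall P w,
  iter k (E1dual (prodsub gs)) (dual_edges P w) =i
  dual_edges (invmx (subst_mx (prodsub gs)) ^+ k *m P + c)
    (iter k (subst_word (proddual gs)) w).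
Proof.
have [c Hc] := E1dual_prodsub gs.
elim: k => [|k [d IHk]]; first by exists 0 => P w p; rewrite expr0 mul1mx addr0.
exists (invmx (subst_mx (prodsub gs)) *m d + c) => P w p.
rewrite iterS (E1dual_eqi (unit_prodsub gs) (IHk P w)) Hc.
by rewrite mulmxDr exprS mulmxA addrA.
Qed.

Theorem dual_codings_strand_space gs :
  dual_codings (@dual_strand_space R (prodsub gs)) = hull (proddual gs).
Proof.
set M := subst_mx (prodsub gs).
apply: (@path_space_hull dstep _ diff_heightD diff_height_dstep R dstep_unit
  dstep_parity (proddual gs)
  (fun W x k => dual_fsum_union (iter k (E1dual (prodsub gs)) [:: (W, x)]))) => W x k;
  have [c Hc] := iter_E1dual gs k.
  eexists; rewrite -dual_union_edges dual_edges1.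
  exact: (dual_union_eqi (Hc _ _)).
have U : invmx M ^+ k \in unitmx by apply: unitrX; rewrite unitrV; exact: unit_prodsub.
exists (invmx (invmx M ^+ k) *m (W - c) - dual_start x).
rewrite -dual_union_edges dual_edges1 subrK (dual_union_eqi (Hc _ _)).
by rewrite -/M mulKVmx // subrK.
Qed.

End Strands.

(** * Perron-Frobenius data of a unimodular matrix of order two *)

Section Perron.
Variable R : realType.

(** The characteristic polynomial of a unimodular matrix of order two. *)
Lemma eigenvalue2 (N : 'M[int]_2) (x : R) : \det N = 1 ->
  eigenvalue (map_mx intr N) x =
  (x ^+ 2 - (N la la + N lb lb)%:~R * x + 1 == 0).
Proof.
move=> detN; rewrite /eigenvalue /eigenspace kermx_eq0 row_free_unit unitmxE unitfE.
rewrite negbK det2 !mxE /=; congr (_ == 0).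
have := congr1 (fun z : int => z%:~R : R) detN; rewrite det2 rmorphB !rmorphM rmorph1 /=.
by move=> E; rewrite rmorphD /= -[X in _ = _ + X]E ?mulr1n ?mulr0n; ring.
Qed.

(** The larger root of x^2 - t x + 1. *)
Definition big_root (t : int) : R := (t%:~R + Num.sqrt (t%:~R ^+ 2 - 4)) / 2.

Section BigRoot.
Variable t : int.
Hypothesis t3 : 3 <= t.
Local Notation lam := (big_root t).

Let tR : 3 <= t%:~R :> R.
Proof. by rewrite (ler_int R 3). Qed.

Lemma big_root_eq : lam ^+ 2 - t%:~R * lam + 1 = 0.
Proof.
have : Num.sqrt (t%:~R ^+ 2 - 4) ^+ 2 = t%:~R ^+ 2 - 4 :> R.
  by rewrite sqr_sqrtr //; have := tR; nra.
rewrite /big_root; set s := Num.sqrt _ => Es.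
have -> : ((t%:~R + s) / 2) ^+ 2 = (t%:~R ^+ 2 + 2 * t%:~R * s + s ^+ 2) / 4 by field.
by rewrite Es; field.
Qed.

Lemma big_root_gt1 : 1 < lam.
Proof.
have := sqrtr_ge0 (t%:~R ^+ 2 - 4 : R); rewrite /big_root; have := tR; lra.
Qed.

Lemma big_rootV : lam^-1 = t%:~R - lam.
Proof.
have l0 : lam != 0 by have := big_root_gt1; lra.
by apply: (mulfI l0); rewrite divff //; have := big_root_eq; lra.
Qed.

Lemma root_cases (x : R) : x ^+ 2 - t%:~R * x + 1 = 0 -> x = lam \/ x = lam^-1.
Proof.
move=> E; have : (x - lam) * (x - lam^-1) = 0.
  by rewrite big_rootV; have := big_root_eq; lra.
by move/eqP; rewrite mulf_eq0 !subr_eq0 => /orP[] /eqP; [left|right].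
Qed.

Lemma perron_big_root (N : 'M[int]_2) : \det N = 1 ->
  N la la + N lb lb = t -> perron R N = lam.
Proof.
move=> detN tN; have l1 := big_root_gt1.
have lV : lam^-1 < lam by apply: lt_trans (l1); rewrite invf_lt1 //; lra.
have eN (x : R) : eigenvalue (map_mx intr N) x = (x ^+ 2 - t%:~R * x + 1 == 0) :> bool.
  by rewrite eigenvalue2 // tN.
apply: xget_unique => [|y [ey maxy]].
  split=> [|y]; first by rewrite eN big_root_eq.
  by rewrite eN => /eqP/root_cases[] ->; rewrite // ltW.
apply/eqP; rewrite eq_le maxy ?eN ?big_root_eq // andbT.
by move: ey; rewrite eN => /eqP/root_cases[] ->; rewrite // ltW.
Qed.

(** Rational roots of the characteristic polynomial would be integers dividing 1. *)
Lemma big_root_irrational (r : rat) : ratr r <> lam.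
Proof.
move=> E; have : ratr (r ^+ 2 - t%:~R * r + 1) = 0 :> R.
  by rewrite rmorphD rmorphB rmorphXn rmorphM rmorph1 /= ratr_int E big_root_eq.
move/eqP; rewrite fmorph_eq0 => /eqP {}E.
have d0 : (denq r)%:~R != 0 :> rat by rewrite intr_eq0 denq_neq0.
have Er : r = (numq r)%:~R / (denq r)%:~R by rewrite divq_num_den.
set n := numq r in Er; set d := denq r in Er d0.
have {E} E : n ^+ 2 - t * n * d + d ^+ 2 = 0.
  apply/eqP; rewrite -(intr_eq0 rat) !(rmorphD, rmorphB, rmorphM, rmorphN) /=.
  apply/eqP; have : (d%:~R) ^+ 2 * (r ^+ 2 - t%:~R * r + 1) = 0 by rewrite E mulr0.
  by move=> <-; rewrite Er; field.
have cop : coprimez n d.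
  rewrite /coprimez /n /d; have := coprime_num_den r.
  by rewrite /coprime /gcdz => /eqP ->.
have : (d %| n * n)%Z.
  by apply/dvdzP; exists (t * n - d); apply/eqP; rewrite -subr_eq0 -E; apply/eqP; ring.
rewrite Gauss_dvdzr ?(coprimez_sym d) // => dn.
have d1 : d = 1.
  have : (d %| gcdz n d)%Z by rewrite dvdz_gcd dn dvdzz.
  rewrite (eqP cop) dvdz1 => /eqP; have := denq_gt0 r; rewrite -/d; lia.
rewrite d1 in E; have {}E : n * (t - n) = 1.
  by apply/eqP; rewrite -subr_eq0 -oppr_eq0 -E; apply/eqP; ring.
have : n = 1 \/ n = -1.
  have : (n %| 1)%Z by apply/dvdzP; exists (t - n); rewrite mulrC.
  by rewrite dvdz1 => /eqP; lia.
by case=> H; rewrite H in E; have := t3; lia.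
Qed.

End BigRoot.

(** * The tile length and its conjugate *)

Section TileLength.
Variable M : 'M[int]_2.
Hypothesis M_ge0 : forall i j, 0 <= M i j.
Hypothesis M_prim : primitive_mx M.
Hypothesis M_det : \det M = 1.

(** A triangular matrix is not primitive. *)
Lemma offdiag_gt0 i j : i != j -> 0 < M i j.
Proof.
move=> ij; rewrite lt_neqAle M_ge0 andbT; apply/eqP => /esym M0.
have [n /(_ i j)] := M_prim.
suff -> : (M ^+ n) i j = 0 by rewrite ltxx.
elim: n => [|n IHn]; first by rewrite expr0 mxE (negPf ij).
rewrite exprS mxE sum_letters; move: ij M0 IHn.
by case: (letterP i) => ->; case: (letterP j) => -> //= _ E IHn;
  rewrite IHn E !(mulr0, mul0r) // addr0.
Qed.

Lemma trace_ge3 : 3 <= M la la + M lb lb.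
Proof.
have b := offdiag_gt0 (isT : la != lb); have c := offdiag_gt0 (isT : lb != la).
have := M_ge0 la la; have := M_ge0 lb lb; have := M_det; rewrite det2.
move: (M la la) (M lb lb) (M la lb) (M lb la) b c => x y z u *; nia.
Qed.

Local Notation t := (M la la + M lb lb).
Local Notation lam := (big_root t).
(** The tile length [l], such that (1, l) is a left eigenvector for the larger
    eigenvalue, and its algebraic conjugate. *)
Definition len : R := (lam - (M la la)%:~R) / (M lb la)%:~R.
Definition conj_len : R := (lam^-1 - (M la la)%:~R) / (M lb la)%:~R.

Let c0 : (M lb la)%:~R != 0 :> R.
Proof. by rewrite intr_eq0; have := offdiag_gt0 (isT : lb != la); lia. Qed.

Let detR : (M la la)%:~R * (M lb lb)%:~R - (M la lb)%:~R * (M lb la)%:~R = 1 :> R.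
Proof.
by have := congr1 (fun z : int => z%:~R : R) M_det; rewrite det2 rmorphB !rmorphM rmorph1.
Qed.

Lemma left_vec_eq (x y : R) : y ^+ 2 - t%:~R * y + 1 = 0 ->
  left_vec x *m map_mx intr M = y *: left_vec x <->
  x = (y - (M la la)%:~R) / (M lb la)%:~R.
Proof.
move=> Ey.
split=> [E|->].
  have := congr1 (fun V : 'rV[R]_2 => V 0 la) E; rewrite !mxE sum_letters !mxE /= => E1.
  by apply: (mulIf c0); rewrite divfK //; lra.
apply/rowP => j; rewrite !mxE sum_letters !mxE /= mul1r.
case: (letterP j) => -> /=; first by rewrite divfK // mulr1 addrC subrK.
have EE : y * (y - (M la la)%:~R) = (M la lb)%:~R * (M lb la)%:~R
    + (y - (M la la)%:~R) * (M lb lb)%:~R.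
  by move: Ey; rewrite rmorphD /=; have := detR; lra.
apply: (mulIf c0); transitivity (y * (y - (M la la)%:~R)); last by field.
by rewrite EE; field.
Qed.

Lemma perronM : perron R M = lam.
Proof. exact: (perron_big_root trace_ge3 M_det). Qed.

Lemma perronMT : perron R M^T = lam.
Proof. by apply: (perron_big_root trace_ge3); rewrite ?det_tr // !mxE. Qed.

Lemma lamV_eq : lam^-1 ^+ 2 - t%:~R * lam^-1 + 1 = 0.
Proof. by rewrite big_rootV ?trace_ge3 //; have := big_root_eq trace_ge3; nra. Qed.

Lemma conj_len_eigen :
  left_vec conj_len *m map_mx intr M = lam^-1 *: left_vec conj_len.
Proof. by apply/left_vec_eq; rewrite ?lamV_eq. Qed.

Lemma conj_len_lt0 : conj_len < 0.
Proof.
have l1 := big_root_gt1 trace_ge3; have lV := big_rootV trace_ge3.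
have c_gt0 : 0 < (M lb la)%:~R :> R by rewrite ltr0z offdiag_gt0.
have b_gt0 : 0 < (M la lb)%:~R :> R by rewrite ltr0z offdiag_gt0.
rewrite /conj_len pmulr_llt0 ?invr_gt0 // subr_lt0 ltNge; apply/negP => le.
have lV1 : lam^-1 < lam by apply: lt_trans (l1); rewrite invf_lt1 //; lra.
have P : ((M la la)%:~R - lam) * ((M la la)%:~R - lam^-1) =
    - ((M la lb)%:~R * (M lb la)%:~R).
  have := detR; have := big_root_eq trace_ge3; rewrite lV rmorphD /=; nra.
have bc : 0 < (M la lb)%:~R * (M lb la)%:~R :> R by apply: mulr_gt0.
by nra.
Qed.

Lemma len_irrational (r : rat) : ratr r <> len.
Proof.
move=> E; apply: (@big_root_irrational _ trace_ge3 ((M la la)%:~R + r * (M lb la)%:~R)).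
by rewrite rmorphD /= rmorphM /= !ratr_int E /len divfK // addrC subrK.
Qed.

Lemma conj_len_irrational (r : rat) : ratr r <> conj_len.
Proof.
move=> E.
apply: (@big_root_irrational _ trace_ge3 (t%:~R - ((M la la)%:~R + r * (M lb la)%:~R))).
rewrite rmorphB /= ratr_int [ratr (_ + _)]rmorphD /= rmorphM /= !ratr_int E /conj_len divfK //.
by rewrite (big_rootV trace_ge3); ring.
Qed.

Lemma conj_len_neq : conj_len != len.
Proof.
have l1 := big_root_gt1 trace_ge3.
have lV1 : lam^-1 < lam by apply: lt_trans (l1); rewrite invf_lt1 //; lra.
by apply/eqP => /(mulIf _)/addIr; rewrite invr_eq0 => /(_ c0) E; rewrite E ltxx in lV1.
Qed.

(** The quadratic polynomial, over the rationals, whose roots are the tile length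
    and its conjugate; it is irreducible, having no rational root. *)
Definition len_poly : {poly rat} := (M lb la)%:~R *: 'X^2 +
  ((M la la - M lb lb)%:~R *: 'X - ((M la lb)%:~R)%:P).

Lemma root_len_poly (x : R) :
  root (map_poly ratr len_poly) x = (x == len) || (x == conj_len).
Proof.
rewrite /len_poly rmorphD /= rmorphB /= !map_polyZ /= map_polyXn map_polyX map_polyC /=.
rewrite !ratr_int /root !hornerE.
rewrite [X in X == 0](_ : _ = (M lb la)%:~R * ((x - len) * (x - conj_len))).
  by rewrite !mulf_eq0 (negPf c0) /= !subr_eq0.
have Eb : (M la lb)%:~R =
    - ((lam - (M la la)%:~R) * (t%:~R - lam - (M la la)%:~R)) / (M lb la)%:~R :> R.
  apply: (mulIf c0); rewrite divfK //.
  by have := detR; have := big_root_eq trace_ge3; rewrite rmorphD /=; lra.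
have E : (M lb la)%:~R * x * x + (M la la - M lb lb)%:~R * x - (M la lb)%:~R =
   (M lb la)%:~R * ((x - len) * (x - conj_len)).
  rewrite Eb /len /conj_len (big_rootV trace_ge3) rmorphB rmorphD /=; field.
  exact: c0.
exact: E.
Qed.

Lemma irreducible_len_poly : irreducible_poly len_poly.
Proof.
apply: cubic_irreducible.
  have cr : (M lb la)%:~R != 0 :> rat by rewrite intr_eq0 -(intr_eq0 R) c0.
  rewrite /len_poly size_polyDl; first by rewrite size_scale // size_polyXn.
  rewrite size_scale // size_polyXn; apply: leq_ltn_trans (size_polyD _ _) _.
  rewrite size_polyN gtn_max; apply/andP; split.
    by apply: leq_ltn_trans (size_scale_leq _ _) _; rewrite size_polyX.
  by apply: leq_ltn_trans (size_polyC_leq1 _) _.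
move=> r; apply/negP => /(rmorph_root (ratr : {rmorphism rat -> R})).
rewrite root_len_poly => /orP[] /eqP; [exact: len_irrational|exact: conj_len_irrational].
Qed.

Lemma conjugate_len : conjugate len = conj_len.
Proof.
apply: xget_unique => [|y [y_len [p [irr pl py]]]].
  split; first exact: conj_len_neq.
  by exists len_poly; split; rewrite ?root_len_poly ?eqxx ?orbT //; apply: irreducible_len_poly.
have : p %| len_poly.
  apply: contraT; rewrite -irreducible_poly_coprime //
    -(coprimep_map (ratr : {rmorphism rat -> R})).
  move/coprimep_root => /(_ _ pl); rewrite -[_ == 0]/(root _ _) root_len_poly eqxx.
  by [].
move/dvdpP => [q Eq]; have := root_len_poly y.
rewrite Eq rmorphM /= rootM py orbT => /esym/orP[] /eqP //.
by move=> E; rewrite E eqxx in y_len.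
Qed.

(** The star map is well defined because the tile length is irrational. *)
Lemma star_len (al be : rat) :
  star len (ratr al + ratr be * len) = ratr al + ratr be * conj_len.
Proof.
apply: xget_unique => [|y]; rewrite conjugate_len; first by exists al, be.
move=> [al' [be' [E ->]]].
have [Eb|nb] := eqVneq be be'.
  by move: E; rewrite -Eb => /addIr ->.
case: (@len_irrational ((al' - al) / (be - be'))).
have nb' : ratr be - ratr be' != 0 :> R.
  by rewrite subr_eq0; apply: contraNneq nb => /fmorph_inj ->.
rewrite fmorph_div !rmorphB /=; apply: (mulIf nb'); rewrite divfK //.
by rewrite mulrBr !(mulrC len); lra.
Qed.

Lemma star_delta w : star len (delta len w) = delta conj_len w.
Proof.
have := star_len (count_mem la w)%:R (count_mem lb w)%:R.
by rewrite !ratr_nat.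
Qed.

End TileLength.

Lemma tile_lengthE sigma : primitive sigma -> \det (subst_mx sigma) = 1 ->
  tile_length R sigma = len (subst_mx sigma).
Proof.
move=> pr det1.
have ge0 i j : 0 <= subst_mx sigma i j by rewrite mxE.
have Ep := perronM ge0 pr det1.
have left := left_vec_eq ge0 pr det1 _ (big_root_eq (trace_ge3 ge0 pr det1)).
by apply: xget_unique => [|l]; rewrite /= Ep; [apply/left|move/left].
Qed.

End Perron.

(** * Uniqueness of the solution of the set equations *)

Section SetEquations.
Variable R : realType.

(** Powers of [x > 1] are unbounded, by the inequality of Bernoulli. *)
Lemma lt_exprn (x C : R) : 1 < x -> exists n, C < x ^+ n.
Proof.
move=> x1.
have bern n : 1 + n%:R * (x - 1) <= x ^+ n.
  elim: n => [|n IHn]; first by rewrite mul0r addr0 expr0.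
  rewrite exprS -natr1; have h0 : 0 < x - 1 by rewrite subr_gt0.
  have A : x * (1 + n%:R * (x - 1)) <= x * x ^+ n by rewrite ler_pM2l //; lra.
  have B : 0 <= n%:R * (x - 1) * (x - 1) by rewrite !mulr_ge0 // ltW.
  by apply: le_trans A; nra.
have h0 : 0 < x - 1 by rewrite subr_gt0.
have := archi_boundP (normr_ge0 (C / (x - 1))); set n := Num.bound _ => Hn.
exists n; apply: lt_le_trans (bern n).
have := ler_norm (C / (x - 1)) => le.
have : C / (x - 1) < n%:R by apply: le_lt_trans Hn.
by rewrite ltr_pdivrMr // => ?; lra.
Qed.

Lemma compact_dist (A B : set R) : compact A -> compact B ->
  exists C : R, 0 <= C /\ forall x y, A x -> B y -> `|x - y| <= C.
Proof.
move=> /compact_bounded[MA [_ HA]] /compact_bounded[MB [_ HB]].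
pose CA := `|MA| + 1; pose CB := `|MB| + 1.
have CA1 : 0 < CA /\ MA < CA.
  by rewrite /CA; have := ler_norm MA; have := normr_ge0 MA; split; lra.
have CB1 : 0 < CB /\ MB < CB.
  by rewrite /CB; have := ler_norm MB; have := normr_ge0 MB; split; lra.
exists (CA + CB); split=> [|x y Ax By]; first by lra.
apply: le_trans (ler_normB _ _) _; apply: lerD;
  [exact: HA (CA1.2) _ Ax|exact: HB (CB1.2) _ By].
Qed.

Variables (D : letter -> letter -> {fset R}) (lam : R).
Hypothesis lam1 : 1 < lam.

(** Any solution is contained in any other one: the inverse branches contract
    distances by the factor [lam^-1]. *)
Lemma set_equations_sub (T T' : letter -> set R) :
  (forall i, T i !=set0 /\ compact (T i)) -> set_equations D lam T ->
  (forall i, T' i !=set0 /\ compact (T' i)) -> set_equations D lam T' ->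
  forall j, T j `<=` T' j.
Proof.
move=> cT eT cT' eT' j x Tx.
have lam0 : 0 < lam by apply: lt_trans lam1.
have [C [C0 HC]] : exists C : R, 0 <= C /\
    forall i x y, T i x -> T' i y -> `|x - y| <= C.
  have [Ca [Ca0 HCa]] := compact_dist (cT la).2 (cT' la).2.
  have [Cb [Cb0 HCb]] := compact_dist (cT lb).2 (cT' lb).2.
  exists (Ca + Cb); split=> [|i y z]; first by lra.
  by case: (letterP i) => -> Ty Tz; [have := HCa _ _ Ty Tz|have := HCb _ _ Ty Tz]; lra.
have approx n : forall i y, T i y -> exists2 z, T' i z & `|y - z| <= C / lam ^+ n.
  elim: n => [|n IHn] i y Ty.
    have [z Tz] := (cT' i).1; exists z => //.
    by rewrite expr0 divr1; apply: HC Ty Tz.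
  have : (\bigcup_(p in [set p : letter * R | p.2 \in D p.1 i]) translate (T p.1) p.2) (lam * y).
    by rewrite -eT; exists y.
  move=> [[k d] /= Dkd [t Tt Et]]; have [z Tz le] := IHn _ _ Tt.
  have : [set lam * y | y in T' i] (z + d).
    by rewrite eT'; exists (k, d) => //; exists z.
  move=> [z' Tz' Ez']; exists z' => //.
  have -> : y - z' = (t - z) / lam.
    apply: (mulfI (lt0r_neq0 lam0)); rewrite mulrBr -Et Ez' mulrC divfK ?lt0r_neq0 //; ring.
  rewrite normrM normfV (gtr0_norm lam0) exprSr invfM mulrA.
  by rewrite ler_pM2r ?invr_gt0.
have closedT' : closed (T' j) by apply: compact_closed (cT' j).2; exact: Rhausdorff.
apply: closedT' => B /nbhs_ballP[e /= e0 eB].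
have [n Hn] := lt_exprn (C / e) lam1.
have [z Tz le] := approx n j x Tx; exists z; split=> //; apply: eB.
rewrite /ball /=; apply: le_lt_trans le _.
have ln0 : 0 < lam ^+ n by rewrite exprn_gt0.
by rewrite ltr_pdivrMr // mulrC -ltr_pdivrMr.
Qed.

Lemma set_equations_unique (T T' : letter -> set R) :
  (forall i, T i !=set0 /\ compact (T i)) -> set_equations D lam T ->
  (forall i, T' i !=set0 /\ compact (T' i)) -> set_equations D lam T' -> T = T'.
Proof.
move=> cT eT cT' eT'; apply/funext => j.
by apply/seteqP; split; exact: set_equations_sub.
Qed.

End SetEquations.

(** * Tiles of the star-dual *)

Section StarDual.
Variable R : realType.
Variable gs : seq gen.
Let sigma := prodsub gs.
Hypothesis pr_sigma : primitive sigma.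

Local Notation M := (subst_mx sigma).
Local Notation rho := (proddual gs).
Local Notation lam := (big_root R (M la la + M lb lb)).
Local Notation m := (conj_len R M).

Let M_ge0 i j : 0 <= M i j. Proof. by rewrite mxE. Qed.
Let detM : \det M = 1. Proof. exact: det_prodsub. Qed.
Let lam1 : 1 < lam. Proof. exact/big_root_gt1/trace_ge3. Qed.
Let lam0 : 0 < lam. Proof. by apply: lt_trans lam1. Qed.
Let lamN0 : lam != 0. Proof. exact: lt0r_neq0. Qed.
Let m0 : m < 0. Proof. exact: conj_len_lt0. Qed.

(** The projection along the expanding direction: the left eigenvector of [M] for
    the contracting eigenvalue, as a linear form. *)
Definition proj (P : point) : R := (P la 0)%:~R + (P lb 0)%:~R * m.

Lemma projD : {morph proj : P Q / P + Q}.
Proof. by move=> P Q; rewrite /proj !mxE !rmorphD /=; ring. Qed.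

Lemma projN : {morph proj : P / - P}.
Proof. by move=> P; rewrite /proj !mxE !rmorphN /=; ring. Qed.

Lemma projB P Q : proj (P - Q) = proj P - proj Q.
Proof. by rewrite projD projN. Qed.

Lemma proj0 : proj 0 = 0.
Proof. by rewrite /proj !mxE; ring. Qed.

Lemma proj_mul P : proj (M *m P) = lam^-1 * proj P.
Proof.
have E (Q : point) : proj Q = (left_vec m *m map_mx intr Q) 0 0.
  by rewrite !mxE !big_ord_recl big_ord0 !mxE /= /proj addr0 mul1r mulrC
    (_ : lift ord0 ord0 = lb) //; apply: val_inj.
by rewrite !E map_mxM mulmxA conj_len_eigen // -scalemxAl mxE.
Qed.

Lemma proj_inv P : proj (invmx M *m P) = lam * proj P.
Proof.
rewrite -{2}[P](mulKVmx (unit_prodsub gs)) proj_mul mulrA divff //.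
by rewrite mul1r.
Qed.

Lemma delta_proj w : delta m w = proj (abel w).
Proof. by rewrite /delta /proj !mxE. Qed.

Let s_star := star_dual (tile_length R sigma) (tile_subst_of R sigma).

(** The digits of the star-dual are the projections of the prefixes. *)
Lemma mem_digits i j d : d \in digits s_star i j <->
  exists u v, sigma i = u ++ j :: v /\ d = proj (abel u).
Proof.
rewrite /s_star /star_dual /tile_subst_of_digits /= tile_lengthE //.
split.
  move=> /imfsetP[x /=]; rewrite in_fset => /mapP[k /occurrences_split Ei -> ->].
  exists (take k (sigma i)), (drop k.+1 (sigma i)).
  by rewrite star_delta // delta_proj.
move=> [u [v [Ei ->]]]; apply/imfsetP; exists (delta (len R M) u) => /=.
  rewrite in_fset; apply/mapP; exists (size u).
    by have := mem_occurrences j u v; rewrite /occurrences -Ei.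
  by rewrite Ei take_size_cat.
by rewrite star_delta // delta_proj.
Qed.

(** Distinct prefixes have distinct projections. *)
Lemma proj_abel_inj w k k' : (k <= size w)%N -> (k' <= size w)%N ->
  proj (abel (take k w)) = proj (abel (take k' w)) -> k = k'.
Proof.
move=> lek lek'; rewrite /proj !mxE => E.
have sz (v : word) : size v = (count_mem la v + count_mem lb v)%N.
  elim: v => //= x v ->; case: (letterP x) => -> /=; lia.
move: E; set x := count_mem la _; set y := count_mem lb _.
set x' := count_mem la _; set y' := count_mem lb _ => E.
have Ey : y = y'.
  have [//|ny] := eqVneq y y'.
  have ny' : (y%:R - y'%:R : R) != 0.
    by rewrite subr_eq0 eqr_nat.
  case: (@conj_len_irrational R M M_ge0 pr_sigma detM ((x'%:R - x%:R) / (y%:R - y'%:R))).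
  rewrite fmorph_div !rmorphB /= !ratr_nat; apply: (mulIf ny'); rewrite divfK //.
  by move: E; rewrite -!pmulrn => E; rewrite mulrBr !(mulrC m); lra.
move: E; rewrite Ey => /addIr /eqP; rewrite eqr_int => /eqP [Ex].
have := sz (take k w); have := sz (take k' w); rewrite !size_takel // => -> ->.
by rewrite -/x -/y -/x' -/y' Ex Ey.
Qed.

Lemma digit_mx_star : digit_mx (digits s_star) = M^T.
Proof.
apply/matrixP => i j; rewrite !mxE; congr Posz.
pose s := [seq proj (abel (take k (sigma i))) | k <- occurrences j (sigma i)].
have us : uniq s.
  rewrite map_inj_in_uniq; first by rewrite filter_uniq // iota_uniq.
  move=> k k'; rewrite !mem_filter !mem_iota /= => /andP[_ /ltnW lt] /andP[_ /ltnW lt'].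
  exact: proj_abel_inj.
have Es : digits s_star i j =i s.
  move=> d; apply/idP/mapP.
    move=> /mem_digits[u [v [Ei ->]]]; exists (size u).
      by rewrite Ei mem_occurrences.
    by rewrite Ei take_size_cat.
  move=> [k /occurrences_split Ei ->].
  by apply/mem_digits; exists (take k (sigma i)), (drop k.+1 (sigma i)).
have -> : #|` digits s_star i j| = size s.
  apply/perm_size/uniq_perm => //; exact: fset_uniq.
by rewrite size_map size_occurrences.
Qed.

Lemma infl_star : infl s_star = lam.
Proof.
have : infl s_star = perron R (digit_mx (digits s_star)) by [].
by rewrite digit_mx_star perronMT.
Qed.


(** The linear part of the dual map maps the displacement of a dual path to the one
    of its image. *)
Lemma displacement_proddual hs w :
  displacement dstep (subst_word (proddual hs) w) =
  invmx (subst_mx (prodsub hs)) *m displacement dstep w.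
Proof.
elim: hs w => [|g hs IH] w.
  by rewrite /proddual subst_id subst_mx_id invmx1 mul1mx.
rewrite /proddual map_cons rev_cons prodsub_rcons -/(proddual hs) IH.
rewrite [prodsub (g :: hs)]/= subst_mx_comp.
rewrite invmxM ?unit_gsub ?unit_prodsub //.
rewrite -mulmxA; congr (_ *m _).
elim: w => [|i w IHw]; first by rewrite /displacement !big_nil mulmx0.
rewrite subst_word_cons displacement_cat displacement_cons IHw mulmxDr.
by rewrite displacement_dual_gen.
Qed.

(** The length of the projection of an elementary dual strand. *)
Definition ell (i : letter) : R := proj (dstep i).

Lemma ell_gt0 i : 0 < ell i.
Proof.
have := m0; rewrite /ell /proj; case: (letterP i) => ->; rewrite /dstep !mxE /=; lra.
Qed.

Lemma proj_displacement_ge0 w : 0 <= proj (displacement dstep w).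
Proof.
elim: w => [|i w IHw]; first by rewrite /displacement big_nil proj0.
by rewrite displacement_cons projD addr_ge0 // ltW // ell_gt0.
Qed.

(** The projected edges of a dual path are consecutive intervals. *)
Lemma edges_cover P w z : w != [::] ->
  proj P <= z <= proj P + proj (displacement dstep w) <->
  exists2 p, p \in edges dstep P w & proj p.1 <= z <= proj p.1 + ell p.2.
Proof.
elim: w P => // i w IHw P _.
rewrite displacement_cons projD -/(ell i).
have [->|w0] := eqVneq w [::].
  rewrite /displacement big_nil proj0 addr0; split.
    by move=> H; exists (P, i) => //=; rewrite inE.
  by move=> [p]; rewrite inE => /eqP ->.
have := IHw (P + dstep i) w0; rewrite projD -/(ell i) => IH.
have e0 := ell_gt0 i; have d0 := proj_displacement_ge0 w.
split.
  move=> /andP[H1 H2]; have [le|/ltW ge] := leP z (proj P + ell i).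
    by exists (P, i); rewrite /= ?inE ?eqxx //= H1.
  have [p pw Hp] := IH.1 ltac:(by rewrite ge -addrA).
  by exists p => //=; rewrite inE pw orbT.
move=> [p]; rewrite /= inE => /orP[/eqP -> /= /andP[H1 H2]|pw Hp].
  by rewrite H1 /=; apply: le_trans H2 _; lra.
have /andP[H1 H2] := IH.2 (ex_intro2 _ _ p pw Hp).
by rewrite addrA H2 andbT; apply: le_trans H1; lra.
Qed.

(** An edge projects to the left of the next ones. *)
Lemma edges_order P w k k' : (k < k' < size w)%N ->
  let p := nth (0, la) (edges dstep P w) in
  proj (p k).1 + ell (p k).2 <= proj (p k').1.
Proof.
move=> /andP[lt lt'] /=; rewrite !nth_edges ?(ltn_trans lt) //= -projD.
have -> : take k' w = take k w ++ nth la w k :: drop k.+1 (take k' w).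
  rewrite -[LHS](cat_take_drop k) take_takel ?(ltnW lt) //; congr (_ ++ _).
  rewrite (drop_nth la) ?nth_take // size_takel // ltnW //.
rewrite displacement_cat displacement_cons !addrA [leRHS]projD lerDl.
exact: proj_displacement_ge0.
Qed.

(** * Set equations of the star-dual *)

(** The vector [c] is the translation part of the dual map of [sigma]. *)
Variable c : point.
Hypothesis Hc : forall P w, E1dual sigma (dual_edges P w) =i
  dual_edges (invmx M *m P + c) (subst_word rho w).

(** The initial vertex and the edges of the dual path [E1dual sigma [:: (0, j)]]. *)
Definition star_start (j : letter) : point := invmx M *m dual_start j + c.

Definition star_edges (j : letter) : seq (point * letter) :=
  edges dstep (star_start j) (rho j).

(** The digit of the tile of the star-dual which corresponds to an edge of the
    dual path [E1dual sigma [:: (0, j)]]. *)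
Definition edge_digit (j : letter) (p : point * letter) : R :=
  (proj (e_ p.2) - proj (p.1 - dual_start p.2)) / lam - proj (e_ j).

(** The vector [A(v)] of the suffix following an occurrence of [j] in [sigma i],
    which gives the position of a dual strand, is determined by the vector [A(u)]
    of the prefix preceding it, which gives the digit. *)
Lemma mem_digits_edge i j d : d \in digits s_star i j <->
  exists2 p, p \in star_edges j & i = p.2 /\ d = edge_digit j p.
Proof.
have U := unit_prodsub gs; rewrite mem_digits.
have Ej p : (p \in E1dual sigma [:: (0, j)]) =
    (p \in dual_edges (star_start j) (rho j)).
  by rewrite dual_edges1 add0r Hc subst_word1.
have key k u v Q : sigma k = u ++ j :: v -> M *m Q = abel v ->
    proj (abel u) = (proj (e_ k) - proj Q) / lam - proj (e_ j).
  move=> Ek EQ; have := congr1 proj (mulmx_e_ M k).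
  rewrite proj_mul (_ : col k M = abel (sigma k)); last first.
    by apply/colP => l; rewrite !mxE.
  rewrite Ek abel_cat abel_cons !projD -EQ proj_mul => E.
  by rewrite mulrBl mulrC E [proj Q / _]mulrC; ring.
split.
  move=> [u [v [Ei ->]]].
  have : (invmx M *m abel v, i) \in E1dual sigma [:: (0, j)].
    apply/(mem_E1dual _ _ _ U); exists 0, j, u, v.
    by rewrite inE eqxx add0r mulKVmx.
  rewrite Ej => /mapP[[S k] Sk]; rewrite /dual_base /= -/(dual_start k) => -[EQ Ek].
  exists (S, k) => //; split=> //; rewrite /edge_digit /= -EQ -Ek.
  by apply: key Ei _; rewrite mulKVmx.
move=> [[S k] Sk [/= -> ->]].
have : dual_base (S, k) \in E1dual sigma [:: (0, j)].
  by rewrite Ej; apply: map_f.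
move=> /(mem_E1dual _ _ _ U)[W [l [u [v [+ Ek EQ]]]]].
rewrite inE => /eqP[EW El]; rewrite EW El add0r in Ek EQ; exists u, v; split=> //.
by rewrite (key k u v _ Ek EQ).
Qed.

(** The tiles are the projections of the elementary dual strands, reversed, scaled
    by [lam^-1], and translated; the translation [kappa] compensates for [c] in the
    set equations. *)
Definition kappa : R := - proj c / (lam * (lam - 1)).
Definition right_end (i : letter) : R :=
  kappa - (proj (dual_start i) + proj (e_ i)) / lam.
Definition star_tile (i : letter) : set R :=
  `[right_end i - ell i / lam, right_end i]%classic.

Lemma lam_sub1 : lam - 1 != 0.
Proof. by rewrite subr_eq0; apply/eqP => E; have := lam1; rewrite E ltxx. Qed.

Lemma kappaE : kappa * lam - kappa * lam ^+ 2 = proj c.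
Proof. by rewrite /kappa; field; rewrite lamN0 lam_sub1. Qed.

Lemma translate_star_tile i d y : translate (star_tile i) d y <->
  right_end i - ell i / lam + d <= y <= right_end i + d.
Proof.
split=> [[z /=]|/andP[H1 H2]].
  by rewrite /star_tile /= in_itv /= => /andP[? ?] <-; apply/andP; split; lra.
exists (y - d); last by rewrite subrK.
by rewrite /star_tile /= in_itv /=; apply/andP; split; lra.
Qed.

(** The tile translated by the digit of an edge is, up to the affine map
    [y |-> lam * (kappa - proj (e_ j) - y)], the projection of this edge. *)
Lemma star_tile_edge j p y :
  translate (star_tile p.2) (edge_digit j p) y <->
  proj p.1 <= lam * (kappa - proj (e_ j) - y) <= proj p.1 + ell p.2.
Proof.
rewrite translate_star_tile /edge_digit /right_end projB.
set s := proj (dual_start _); set e := proj (e_ p.2); set f := proj (e_ j).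
have E1 : kappa - (s + e) / lam + ((e - (proj p.1 - s)) / lam - f) =
    kappa - f - proj p.1 / lam by field; exact: lamN0.
have E2 : kappa - (s + e) / lam - ell p.2 / lam + ((e - (proj p.1 - s)) / lam - f) =
    kappa - f - (proj p.1 + ell p.2) / lam by field; exact: lamN0.
rewrite E1 E2.
have H (x : R) : (kappa - f - x / lam <= y) = (lam * (kappa - f - y) <= x).
  by rewrite [lam * _]mulrC -ler_pdivlMr //; apply/idP/idP; lra.
have H' (x : R) : (y <= kappa - f - x / lam) = (x <= lam * (kappa - f - y)).
  by rewrite [lam * _]mulrC -ler_pdivrMr //; apply/idP/idP; lra.
by rewrite H H' andbC.
Qed.

Lemma proddual_neq0 j : rho j != [::].
Proof. exact: nonerasing_prodsub. Qed.

Lemma proj_star_start j : proj (star_start j) = lam * proj (dual_start j) + proj c.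
Proof. by rewrite projD proj_inv. Qed.

Lemma proj_displacement_star j : proj (displacement dstep (rho j)) = lam * ell j.
Proof.
by rewrite -[rho j]subst_word1 displacement_proddual proj_inv /displacement big_seq1.
Qed.

Lemma star_tile_equations : set_equations (digits s_star) lam star_tile.
Proof.
move=> j.
have cover x : (exists2 p, p \in star_edges j &
    translate (star_tile p.2) (edge_digit j p) x) <-> star_tile j (x / lam).
  have := edges_cover (star_start j) (lam * (kappa - proj (e_ j) - x)) (proddual_neq0 j).
  rewrite proj_star_start proj_displacement_star => cov.
  have -> : star_tile j (x / lam) <->
      lam * proj (dual_start j) + proj c <= lam * (kappa - proj (e_ j) - x)
        <= lam * proj (dual_start j) + proj c + lam * ell j.
    rewrite /star_tile /= in_itv /= ler_pdivlMr // ler_pdivrMr // -kappaE /right_end.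
    set s := proj (dual_start _); set e := proj (e_ _); set l := ell j.
    have E1 : (kappa - (s + e) / lam - l / lam) * lam = kappa * lam - s - e - l.
      by field; exact: lamN0.
    have E2 : (kappa - (s + e) / lam) * lam = kappa * lam - s - e.
      by field; exact: lamN0.
    rewrite E1 E2 [in X in _ <-> X]andbC.
    have F1 : (kappa * lam - s - e - l <= x) =
        (lam * (kappa - e - x) <= lam * s + (kappa * lam - kappa * lam ^+ 2) + lam * l).
      rewrite -(ler_pM2l lam0); apply/idP/idP; nra.
    have F2 : (x <= kappa * lam - s - e) =
        (lam * s + (kappa * lam - kappa * lam ^+ 2) <= lam * (kappa - e - x)).
      rewrite -(ler_pM2l lam0); apply/idP/idP; nra.
    by rewrite F1 F2.
  apply: iff_trans (iff_sym cov).
  by split=> -[p pj Hp]; exists p => //; exact/star_tile_edge.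
apply/seteqP; split=> x.
  move=> [y Ty <-]; have : star_tile j (lam * y / lam) by rewrite mulrC mulKf.
  move=> /cover[p pj Hp]; exists (p.2, edge_digit j p) => //=.
  by apply/mem_digits_edge; exists p.
move=> [[i d] /= /mem_digits_edge[p pj [-> ->]] Hx].
exists (x / lam); last by rewrite mulrC divfK.
by apply/cover; exists p.
Qed.

Lemma star_tile_compact i : star_tile i !=set0 /\ compact (star_tile i).
Proof.
split; last exact: segment_compact.
exists (right_end i); rewrite /star_tile /= in_itv /= lexx andbT lerBlDr lerDl.
by rewrite ltW // divr_gt0 // ell_gt0.
Qed.

Lemma proto_star : proto s_star = star_tile.
Proof.
have E : perron R (digit_mx (digits s_star)) = lam by rewrite digit_mx_star perronMT.
apply: xget_unique => [|T [cT eT]].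
  split; first exact: star_tile_compact.
  by rewrite E; exact: star_tile_equations.
rewrite E in eT; apply/esym.
exact: (set_equations_unique lam1 star_tile_compact star_tile_equations cT eT).
Qed.

(** Along the dual path the tiles go from right to left. *)
Lemma tile_order j k k' y z : (k < k' < size (rho j))%N ->
  let p := nth (0, la) (star_edges j) in
  tile s_star ((p k).2, edge_digit j (p k)) y ->
  tile s_star ((p k').2, edge_digit j (p k')) z -> z <= y.
Proof.
move=> lt; have := edges_order (star_start j) lt => /= le.
rewrite /tile proto_star /=.
move=> /star_tile_edge/andP[_ H1] /star_tile_edge/andP[H2 _].
have : lam * (kappa - proj (e_ j) - y) <= lam * (kappa - proj (e_ j) - z).
  by apply: le_trans H1 (le_trans le H2).
by rewrite ler_pM2l //; lra.
Qed.

(** Sets of reals lying on both sides of a point have disjoint interiors. *)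
Lemma interior_ordered (A B : set R) : (forall y z, A y -> B z -> y <= z) ->
  interior A `&` interior B = set0.
Proof.
move=> le; rewrite -subset0 => x [/nbhs_ballP[e /= e0 eA] /nbhs_ballP[f /= f0 fB]].
have Ax : A (x + e / 2).
  by apply: eA; rewrite /ball /= opprD addNKr normrN gtr0_norm; lra.
have Bx : B (x - f / 2).
  by apply: fB; rewrite /ball /= opprB addrCA subrr addr0 gtr0_norm; lra.
by have := le _ _ Ax Bx; lra.
Qed.

Lemma primitive_s_star : primitive_tile_subst s_star.
Proof.
split; last first.
  have [n Hn] := pr_sigma; exists n => i j.
  by rewrite digit_mx_star trmx_exp mxE.
split.
- move=> i; exists (right_end i - ell i / lam), (right_end i).
  rewrite proto_star; split=> //.
  by rewrite ltrBlDr ltrDl divr_gt0 // ell_gt0.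
- by rewrite infl_star.
- by rewrite infl_star proto_star; exact: star_tile_equations.
move=> j [i d] [i' d'] neq /= /mem_digits_edge[p pj [Ei Ed]]
  /mem_digits_edge[p' pj' [Ei' Ed']].
have [k] := nthP (0, la) pj; rewrite size_edges => lt Ep.
have [k'] := nthP (0, la) pj'; rewrite size_edges => lt' Ep'.
have [kk'|kk'|kk'] := ltngtP k k'.
- rewrite setIC; apply: interior_ordered => y z Hy Hz.
  apply: (@tile_order j k k' z y) => //=; first by rewrite kk'.
    by rewrite Ep -Ei -Ed.
  by rewrite Ep' -Ei' -Ed'.
- apply: interior_ordered => y z Hy Hz.
  apply: (@tile_order j k' k z y) => //=; first by rewrite kk'.
    by rewrite Ep' -Ei' -Ed'.
  by rewrite Ep -Ei -Ed.
- by case/eqP: neq; rewrite Ei Ed Ei' Ed' -Ep -Ep' kk'.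
Qed.

(** The star-dual reads the mirror image of the dual substitution. *)
Lemma reads_s_star : reads (mirror rho) s_star.
Proof.
move=> j; exists (rev (map (edge_digit j) (star_edges j))).
have sz : size (star_edges j) = size (rho j) by rewrite size_edges.
have Ez : mirror rho j = rev (map snd (star_edges j)).
  by rewrite map_snd_edges.
split.
- by rewrite /mirror /= !size_rev size_map.
- move=> i d; rewrite Ez -!map_rev zip_map.
  apply/idP/mapP.
    by move=> /mem_digits_edge[p pj [-> ->]]; exists p; rewrite ?mem_rev.
  move=> [p]; rewrite mem_rev => pj [-> ->]; apply/mem_digits_edge; by exists p.
move=> k k' lt y z; rewrite /mirror /= size_rev in lt.
have lt1 : (k < size (rho j))%N by case/andP: lt => *; lia.
have lt2 : (k' < size (rho j))%N by case/andP: lt.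
have nthE i : (i < size (rho j))%N ->
  (nth la (mirror rho j) i, nth 0 (rev (map (edge_digit j) (star_edges j))) i) =
  (fun p => (p.2, edge_digit j p)) (nth (0, la) (star_edges j) (size (rho j) - i.+1)).
  move=> lti; rewrite Ez !nth_rev ?size_map ?sz // !(nth_map (0, la)) ?sz //; lia.
rewrite !nthE // => Hy Hz.
apply: (@tile_order j (size (rho j) - k'.+1) (size (rho j) - k.+1) z y) => //.
by case/andP: lt => *; lia.
Qed.

End StarDual.

Theorem theorem5p10 (R : realType) (sigma : substitution)
  (sigma_ne : nonerasing sigma) (sigma_prim : primitive sigma)
  (sigma_inv : invertible sigma) (det1 : \det (subst_mx sigma) = 1) :
  let s := tile_subst_of R sigma in
  let s_star := star_dual (tile_length R sigma) s in
  let sigma_star := dual_subst R sigma in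
  let sigma_bar := reciprocal sigma in
  [/\ space_equiv (DualStrands R (dual_strand_space R sigma))
                  (Strands R (strand_space R sigma_star)),
      space_equiv (Strands R (strand_space R sigma_star))
                  (Hull R (hull sigma_bar)),
      space_equiv (Hull R (hull sigma_bar)) (Hull R (hull sigma_star)) &
      space_equiv (Hull R (hull sigma_star)) (Tilings (tiling_space s_star))].
Proof.
have [gs Es] := invertible_prodsub sigma_ne sigma_inv det1.
move=> s s_star sigma_star sigma_bar.
have Estar : sigma_star = proddual gs by rewrite /sigma_star Es dual_subst_prodsub.
have Ebar : sigma_bar = swap_sub (proddual gs).
  by rewrite /sigma_bar Es reciprocal_prodsub -?Es // prodbar_swap.
subst sigma; move: sigma_star sigma_bar Estar Ebar => _ _ -> ->.
have ne_star : nonerasing (proddual gs) := @nonerasing_prodsub _.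
have prim_star := primitive_proddual sigma_prim.
have prim_bar := primitive_swap prim_star.
have ne_bar : nonerasing (swap_sub (proddual gs)).
  by move=> x; rewrite /swap_sub -size_eq0 size_map size_eq0.
have eq_bar : hull_equiv (hull (swap_sub (proddual gs))) (hull (proddual gs)).
  by right; rewrite hull_swap.
have strands : space_link (Hull R (hull (proddual gs)))
    (Strands R (strand_space R (proddual gs))).
  by apply: link_hull_strands => //; rewrite codings_strand_space // det_prodsub.
have dual_strands : space_link (Hull R (hull (proddual gs)))
    (DualStrands R (dual_strand_space R (prodsub gs))).
  by apply: link_hull_dual_strands => //; exact: dual_codings_strand_space.
(* Every space is linked to the hull of the dual substitution, the tilings through
   the equal hull of its mirror image. *)
split.
- apply: rst_trans (rst_step _ _ _ _ strands).
  exact/rst_sym/rst_step.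
- apply: rst_trans (rst_sym _ _ _ _ (rst_step _ _ _ _ strands)) _.
  exact/rst_sym/rst_step/link_hull.
- exact: eq_bar.
have [c Hc] := E1dual_prodsub gs.
have prim_mirror : primitive (mirror (proddual gs)).
  exact: primitive_eq_mx (esym (subst_mx_mirror _)) prim_star.
have ne_mirror : nonerasing (mirror (proddual gs)).
  by move=> x; rewrite /mirror /= -size_eq0 size_rev size_eq0.
apply: (@rst_trans _ _ _ (Hull R (hull (mirror (proddual gs))))).
  by apply/rst_step/link_hull => //; left; rewrite hull_mirror.
apply/rst_step/link_hull_tilings => //.
- exact: primitive_s_star Hc.
- by right; exact: reads_s_star Hc.
Qed.
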